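(* Let $\rho>0$, $C_2>0$ and $\varepsilon>0$ be numbers, let $f$ be an entire function and let $E\subset\mathbb{C}$ be a set such that $$\bigl||z|^\rho-\log|f(z)|\bigr|\le C_2\log|z|\qquad\text{for all } z\notin E,$$ where $E$ is contained in the union of disks $D(z_j,r_j)$, $j\in\mathbb{N}$, with $r_j\le |z_j|^{1-\rho/2+\varepsilon}$ for all $j$. Then there is a number $R(\varepsilon)$ such that $$\sum_{R\le|z_j|<2R} r_j\ \ge\ R^{1+\rho/2-2C_2-3\varepsilon}\qquad\text{for all } R>R(\varepsilon).$$
   Context: $D(a,r)=\{z\in\mathbb{C}:|z-a|<r\}$. The sum is over all indices $j$ with $R\le|z_j|<2R$.
   Formalization: Two assumptions are added, without which the disks may cover all of ℂ and the claim fails: ε ≤ ρ/2, and the radii r_j of the disks with |z_j| ≤ 1 are bounded (automatic when 1−ρ/2+ε ≥ 0). *)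

(* Defs.v *)
From Stdlib Require Import Reals.
From Coquelicot Require Import Coquelicot.
Open Scope R_scope.

Definition entire (f : C -> C) : Prop :=
  forall w : C, ex_derive (K := C_AbsRing) (V := C_NormedModule) f w.

Definition disk (a : C) (r : R) (w : C) : Prop := Cmod (w - a)%C < r.

(* t^a for t >= 0.  Stdlib's [Rpower] is only meaningful for a positive base
   ([Rpower 0 a = 1]); here 0^0 = 1 and 0^a = 0 for every a <> 0, including
   a < 0, where the power is undefined. *)
Definition rpow (t a : R) : R :=
  if Rlt_dec 0 t then Rpower t a else if Req_dec_T a 0 then 1 else 0.

(* log t for t >= 0, with log 0 = -oo.  Stdlib's [ln 0] is 0, which would let
   zeros of f satisfy an estimate on log|f|. *)
Definition xlog (t : R) : Rbar :=
  if Rlt_dec 0 t then Finite (ln t) else m_infty.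

(* The sum of r_j over the j with T <= |z_j| < 2T, as an extended real.  For
   r_j >= 0 the partial sums increase, so [Lim_seq] is their limit, +oo
   when the sum diverges. *)
Definition annulus_sum (z : nat -> C) (r : nat -> R) (T : R) : Rbar :=
  Lim_seq (sum_n (fun j =>
    if Rle_dec T (Cmod (z j)) then
      if Rlt_dec (Cmod (z j)) (2 * T) then r j else 0
    else 0)).

(* Main.v *)
(* Near a zero [p] of [f] with [|p| ~ T], write [|w|^rho] as the real part of an affine
   function [g] plus a bounded error on the disk of radius [T^(1-rho/2)].  If the
   exceptional disks near [p] have small total radius, there are circles avoiding them,
   so Cauchy's estimate makes [f e^(-g)] Lipschitz with constant about
   [T^(C2 - 1 + rho/2)]; vanishing at [p], it is smaller than [T^(-C2)] up to
   distance about [T^(1-rho/2-2*C2)] from [p], and this neighbourhood of [p] lies in [E].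
   A disk of radius [T^(1-rho/2+eps)] must contain a zero: otherwise [log |f|] would be
   harmonic there and could not follow the strictly subharmonic [|w|^rho].  So every
   disk of this radius in the annulus contributes about [T^(1-rho/2-2*C2)] to the sum.
   About [T^(rho-2*eps)] such disks can be placed so far apart that no exceptional
   disk, having radius at most [2 * T^(1-rho/2+eps)], is counted twice; [eps/2] of the
   remaining [eps] in the exponent gives room to each local bound, the rest absorbs
   constants. *)
Require Import Defs.
From Stdlib Require Import Reals Lra Lia Psatz Classical.
From Coquelicot Require Import Coquelicot.
Open Scope R_scope.

(** * Complex differentiability *)

(** At distance [s] from a point of modulus about [T], the second order Taylor term of [|w|^rho] has
    size [T^(rho-2) * s^2]. The radius [T^(1-rho/2)] is the scale at which this stays bounded.
    Enlarging it by the factor [T^eps] makes the term as large as [T^(2*eps)], which beats the error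
    [C2 * ln T]; hence a zero is forced only on the larger scale. The loss [2 * C2] is the error
    counted twice: as an upper bound for [f e^(-g)] on circles, and as a lower bound at a point
    close to the zero. Since [log |f|] is controlled only off the exceptional disks, the comparison
    points and circles have to be chosen free of them; this is a one-dimensional covering argument
    for distances to a fixed point. The complex analysis is reduced to real integrals over sides of
    rectangles: [w -> p + e^w] turns circles into vertical segments, so Goursat's theorem on
    rectangles yields Cauchy's estimate and the maximum principle at the centre of a disk. *)

Definition cder (F : C -> C) (p l : C) : Prop :=
  forall e, 0 < e -> exists d, 0 < d /\ forall h : C, Cmod h < d ->
    Cmod (F (p + h) - F p - l * h)%C <= e * Cmod h.

Lemma Cmod_sub_comm (x y : C) : Cmod (x - y) = Cmod (y - x).
Proof. rewrite <- Cmod_opp. f_equal. ring. Qed.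

Lemma Cmod_triangle_sub (x y : C) : Cmod x <= Cmod (x - y) + Cmod y.
Proof.
  replace x with ((x - y) + y)%C at 1 by ring. apply Cmod_triangle.
Qed.

Lemma Cmod_sub_triangle (x y z : C) : Cmod (x - z) <= Cmod (x - y) + Cmod (y - z).
Proof.
  replace (x - z)%C with ((x - y) + (y - z))%C by ring. apply Cmod_triangle.
Qed.

Lemma ex_derive_cder (F : C -> C) (p : C) :
  ex_derive (K := C_AbsRing) (V := C_NormedModule) F p -> exists l, cder F p l.
Proof.
  intros [l [_ Hd]]. exists l. intros e He.
  assert (Hlim : is_filter_lim (locally (T := AbsRing_UniformSpace C_AbsRing) p)
                   (p : AbsRing_NormedModule C_AbsRing)).
  { intros P HP. exact HP. }
  specialize (Hd p Hlim (mkposreal e He)).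
  destruct Hd as [d Hd]. exists d. split; [apply cond_pos|].
  intros h Hh. specialize (Hd (p + h)%C).
  (* Balls and norms over [C_AbsRing] unfold to [Cmod], so both uses of [change] hold by
     conversion. *)
  assert (Hb : ball (M := AbsRing_UniformSpace C_AbsRing) p d (p + h)%C).
  { change (Cmod ((p + h) - p)%C < d). replace ((p + h) - p)%C with h by ring. exact Hh. }
  specialize (Hd Hb).
  change (Cmod ((F (p + h) - F p) - ((p + h) - p) * l)%C <= e * Cmod ((p + h) - p)%C) in Hd.
  replace ((p + h) - p)%C with h in Hd by ring.
  replace (F (p + h) - F p - l * h)%C with ((F (p + h)%C - F p) - h * l)%C by ring. exact Hd.
Qed.

Lemma cder_cont (F : C -> C) (p l : C) : cder F p l ->
  forall e, 0 < e -> exists d, 0 < d /\ forall h, Cmod h < d -> Cmod (F (p + h) - F p)%C < e.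
Proof.
  intros H e He. destruct (H 1 Rlt_0_1) as [d [Hd H1]].
  pose proof (Cmod_ge_0 l) as Hl.
  exists (Rmin d (e / (2 + Cmod l))). split.
  { apply Rmin_pos; auto. apply Rdiv_lt_0_compat; lra. }
  intros h Hh.
  assert (Hh1 := Rlt_le_trans _ _ _ Hh (Rmin_l _ _)).
  assert (Hh2 := Rlt_le_trans _ _ _ Hh (Rmin_r _ _)).
  specialize (H1 h Hh1).
  eapply Rle_lt_trans; [apply (Cmod_triangle_sub _ (l * h)%C)|].
  rewrite Cmod_mult. apply Rlt_div_r in Hh2; [|lra].
  pose proof (Cmod_ge_0 h). nra.
Qed.

Lemma cder_ext (F G : C -> C) (p l m : C) :
  (forall w, F w = G w) -> l = m -> cder F p l -> cder G p m.
Proof.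
  intros H <- HF e He. destruct (HF e He) as [d [Hd H1]]. exists d. split; auto.
  intros h Hh. rewrite <- !H. auto.
Qed.

Lemma cder_affine (a b p : C) : cder (fun w => a * w + b)%C p a.
Proof.
  intros e He. exists 1. split; [lra|]. intros h _.
  replace (a * (p + h) + b - (a * p + b) - a * h)%C with (RtoC 0) by ring.
  rewrite Cmod_0. pose proof (Cmod_ge_0 h). nra.
Qed.

Lemma cder_plus (F G : C -> C) (p l m : C) :
  cder F p l -> cder G p m -> cder (fun w => F w + G w)%C p (l + m)%C.
Proof.
  intros HF HG e He.
  destruct (HF (e / 2)) as [d1 [Hd1 H1]]; [lra|].
  destruct (HG (e / 2)) as [d2 [Hd2 H2]]; [lra|].
  exists (Rmin d1 d2). split; [now apply Rmin_pos|]. intros h Hh.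
  specialize (H1 h (Rlt_le_trans _ _ _ Hh (Rmin_l _ _))).
  specialize (H2 h (Rlt_le_trans _ _ _ Hh (Rmin_r _ _))).
  replace (F (p + h) + G (p + h) - (F p + G p) - (l + m) * h)%C with
    ((F (p + h) - F p - l * h) + (G (p + h) - G p - m * h))%C by ring.
  eapply Rle_trans; [apply Cmod_triangle|]. lra.
Qed.

Lemma cder_mult (F G : C -> C) (p l m : C) :
  cder F p l -> cder G p m -> cder (fun w => F w * G w)%C p (l * G p + F p * m)%C.
Proof.
  intros HF HG e He.
  (* The remainder splits below into three terms, each at most [e' * B * Cmod h], a third of the
     allowed error. The summand 1 covers the oscillation of [G] near [p]. *)
  set (B := Cmod (G p) + 1 + Cmod (F p) + Cmod l).
  assert (Hp := Cmod_ge_0 (G p)). assert (Hp' := Cmod_ge_0 (F p)). assert (Hl := Cmod_ge_0 l).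
  assert (HB : 0 < B) by (unfold B; lra).
  assert (He' : 0 < e / (3 * B)) by (apply Rdiv_lt_0_compat; lra).
  assert (Hee : e / (3 * B) * B = e / 3) by (field; lra).
  set (e' := e / (3 * B)) in *.
  destruct (HF e' He') as [d1 [Hd1 H1]].
  destruct (HG e' He') as [d2 [Hd2 H2]].
  destruct (cder_cont _ _ _ HG (Rmin 1 e')) as [d3 [Hd3 H3]]; [apply Rmin_pos; lra|].
  exists (Rmin d1 (Rmin d2 d3)). split; [repeat apply Rmin_pos; auto|]. intros h Hh.
  pose proof (Rmin_l d1 (Rmin d2 d3)). pose proof (Rmin_r d1 (Rmin d2 d3)).
  pose proof (Rmin_l d2 d3). pose proof (Rmin_r d2 d3).
  specialize (H1 h ltac:(lra)). specialize (H2 h ltac:(lra)). specialize (H3 h ltac:(lra)).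
  pose proof (Rmin_l 1 e'). pose proof (Rmin_r 1 e').
  replace (F (p + h) * G (p + h) - F p * G p - (l * G p + F p * m) * h)%C with
    ((F (p + h) - F p - l * h) * G (p + h) + F p * (G (p + h) - G p - m * h)
      + l * h * (G (p + h) - G p))%C by ring.
  eapply Rle_trans; [apply Cmod_triangle|].
  eapply Rle_trans; [apply Rplus_le_compat_r, Cmod_triangle|].
  rewrite !Cmod_mult.
  assert (HG1 : Cmod (G (p + h)%C) <= Cmod (G p) + 1).
  { eapply Rle_trans; [apply (Cmod_triangle_sub _ (G p))|]. lra. }
  pose proof (Cmod_ge_0 h). pose proof (Cmod_ge_0 (G (p + h)%C)).
  assert (A1 : Cmod (F (p + h)%C - F p - l * h) * Cmod (G (p + h)%C) <= (e' * Cmod h) * B).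
  { apply Rmult_le_compat; auto; try apply Cmod_ge_0. unfold B; lra. }
  assert (A2 : Cmod (F p) * Cmod (G (p + h)%C - G p - m * h) <= B * (e' * Cmod h)).
  { apply Rmult_le_compat; auto; try apply Cmod_ge_0. unfold B; lra. }
  assert (A3 : Cmod l * Cmod h * Cmod (G (p + h)%C - G p)%C <= (B * Cmod h) * e').
  { apply Rmult_le_compat; auto; try apply Cmod_ge_0. apply Rmult_le_pos; auto.
    apply Rmult_le_compat_r; auto. unfold B; lra. lra. }
  assert (Hx : e' * Cmod h * B = e / 3 * Cmod h) by (rewrite <- Hee; ring).
  nra.
Qed.

Lemma cder_comp (F G : C -> C) (p l m : C) :
  cder G p m -> cder F (G p) l -> cder (fun w => F (G w)) p (l * m)%C.
Proof.
  intros HG HF e He.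
  pose proof (Cmod_ge_0 m) as Hm. pose proof (Cmod_ge_0 l) as Hl.
  set (B := 1 + Cmod m + Cmod l).
  assert (HB : 0 < B) by (unfold B; lra).
  assert (He' : 0 < e / (2 * B)) by (apply Rdiv_lt_0_compat; lra).
  assert (Hee : e / (2 * B) * B = e / 2) by (field; lra).
  set (e' := e / (2 * B)) in *.
  destruct (HF e' He') as [d1 [Hd1 H1]].
  (* The bound 1 gives the Lipschitz estimate [A], the bound [e'] the smallness [A1]. *)
  destruct (HG (Rmin 1 e')) as [d2 [Hd2 H2]]; [apply Rmin_pos; lra|].
  destruct (cder_cont _ _ _ HG d1 Hd1) as [d3 [Hd3 H3]].
  exists (Rmin d2 d3). split; [now apply Rmin_pos|]. intros h Hh.
  pose proof (Rmin_l d2 d3). pose proof (Rmin_r d2 d3).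
  specialize (H2 h ltac:(lra)). specialize (H3 h ltac:(lra)).
  pose proof (Rmin_l 1 e'). pose proof (Rmin_r 1 e').
  specialize (H1 _ H3).
  replace (G p + (G (p + h) - G p))%C with (G (p + h)%C) in H1 by ring.
  replace (F (G (p + h)) - F (G p) - l * m * h)%C with
    ((F (G (p + h)) - F (G p) - l * (G (p + h) - G p)) + l * (G (p + h) - G p - m * h))%C by ring.
  eapply Rle_trans; [apply Cmod_triangle|]. rewrite Cmod_mult.
  pose proof (Cmod_ge_0 h).
  assert (A : Cmod (G (p + h)%C - G p)%C <= B * Cmod h).
  { eapply Rle_trans; [apply (Cmod_triangle_sub _ (m * h)%C)|].
    rewrite Cmod_mult. unfold B. nra. }
  assert (A1 : Cmod (G (p + h)%C - G p - m * h) <= e' * Cmod h) by nra.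
  assert (A2 : Cmod l * Cmod (G (p + h)%C - G p - m * h) <= B * (e' * Cmod h)).
  { apply Rmult_le_compat; auto; try apply Cmod_ge_0. unfold B; lra. }
  assert (Hx : e' * (B * Cmod h) = e / 2 * Cmod h) by (rewrite <- Hee; ring).
  nra.
Qed.

Lemma cder_inv (p : C) : p <> 0 -> cder Cinv p (- / (p * p))%C.
Proof.
  intros Hp e He. assert (Hm := proj1 (Cmod_gt_0 p) Hp).
  set (c := Cmod p) in *.
  (* The remainder is exactly [h^2 / (p^2 (p + h))]. The first bound keeps [Cmod (p + h)] above
     [c / 2], so the remainder is at most [2 |h|^2 / c^3]; the second makes this at most [e |h|]. *)
  exists (Rmin (c / 2) (e * (c * c * c) / 2)). split.
  { apply Rmin_pos; [lra|]. apply Rdiv_lt_0_compat; [|lra]. repeat apply Rmult_lt_0_compat; auto. }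
  intros h Hh.
  pose proof (Rlt_le_trans _ _ _ Hh (Rmin_l _ _)) as h1.
  pose proof (Rlt_le_trans _ _ _ Hh (Rmin_r _ _)) as h2.
  assert (Hph : c / 2 <= Cmod (p + h)).
  { pose proof (Cmod_triangle_sub p (p + h)) as H.
    replace (p - (p + h))%C with (- h)%C in H by ring. rewrite Cmod_opp in H. fold c in H. lra. }
  assert (Hn : (p + h)%C <> 0) by (apply Cmod_gt_0; lra).
  replace (/ (p + h) - / p - - / (p * p) * h)%C with (h * h * / (p * p * (p + h)))%C by (field; auto).
  rewrite !Cmod_mult, Cmod_inv, !Cmod_mult by (repeat apply Cmult_neq_0; auto). fold c.
  pose proof (Cmod_ge_0 h) as Hh0.
  rewrite <- Rdiv_def. apply Rle_div_l.
  { repeat apply Rmult_lt_0_compat; lra. }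
  assert (e * (c * c * c) / 2 <= e * (c * c * Cmod (p + h))).
  { assert (c * c * (c/2) <= c * c * Cmod (p + h)) by (apply Rmult_le_compat_l; nra). nra. }
  nra.
Qed.

(** * The complex exponential *)

Definition cexp (w : C) : C := (exp (fst w) * cos (snd w), exp (fst w) * sin (snd w)).

Lemma cexp_plus (a b : C) : cexp (a + b) = (cexp a * cexp b)%C.
Proof.
  unfold cexp. destruct a as [x y], b as [u v]. unfold Cplus, Cmult. simpl.
  rewrite exp_plus, cos_plus, sin_plus. f_equal; ring.
Qed.

Lemma cexp_0 : cexp 0 = 1.
Proof. unfold cexp. simpl. rewrite exp_0, cos_0, sin_0. unfold RtoC. f_equal; ring. Qed.

Lemma Cmod_cexp (w : C) : Cmod (cexp w) = exp (fst w).
Proof.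
  unfold Cmod, cexp. simpl.
  replace (_ + _) with (Rsqr (exp (fst w)) * (Rsqr (sin (snd w)) + Rsqr (cos (snd w)))) by (unfold Rsqr; ring).
  rewrite sin2_cos2, Rmult_1_r. apply sqrt_Rsqr. left. apply exp_pos.
Qed.

Lemma cexp_neq_0 (w : C) : cexp w <> 0.
Proof. apply Cmod_gt_0. rewrite Cmod_cexp. apply exp_pos. Qed.

(** The inequality [1 + y <= exp y] at [x] and at [- x] encloses [exp x] between [1 + x] and
    [1 / (1 - x)], and these differ by [x^2 / (1 - x)]. *)
Lemma exp_sub_1_bound (x : R) : Rabs x <= / 2 -> Rabs (exp x - 1 - x) <= 2 * (x * x).
Proof.
  intros H. pose proof (exp_ineq1_le x). pose proof (exp_ineq1_le (- x)).
  apply Rabs_le_between in H.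
  rewrite Rabs_pos_eq by lra.
  assert (exp x * exp (- x) = 1) by (rewrite <- exp_plus, Rplus_opp_r; apply exp_0).
  pose proof (exp_pos x).
  assert (exp x * (1 - x) <= 1) by nra. nra.
Qed.

Lemma sin_bound (y : R) : Rabs (sin y) <= Rabs y.
Proof.
  destruct (MVT_gen sin 0 y cos) as [c [_ Hc]].
  - intros x _. auto_derive; auto. ring.
  - intros x _. apply continuity_pt_filterlim, continuous_sin.
  - rewrite sin_0, !Rminus_0_r in Hc. rewrite Hc, Rabs_mult.
    pose proof (COS_bound c). assert (Rabs (cos c) <= 1) by (apply Rabs_le; lra).
    pose proof (Rabs_pos y). nra.
Qed.

Lemma one_sub_cos_bound (y : R) : Rabs (cos y - 1) <= y * y.
Proof.
  replace (cos y - 1) with (- (2 * (sin (y / 2) * sin (y / 2)))).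
  2:{ replace y with (2 * (y / 2)) at 3 by field. rewrite cos_2a_sin. ring. }
  rewrite Rabs_Ropp, Rabs_pos_eq by nra.
  pose proof (sin_bound (y / 2)) as H. apply Rsqr_le_abs_1 in H. unfold Rsqr in H. nra.
Qed.

Lemma sin_sub_bound (y : R) : Rabs y <= 1 -> Rabs (sin y - y) <= y * y.
Proof.
  intros Hy.
  destruct (MVT_gen (fun t => sin t - t) 0 y (fun t => cos t - 1)) as [c [Hc H]].
  - intros x _. auto_derive; auto. ring.
  - intros x _. apply continuity_pt_filterlim.
    apply (continuous_minus (V := R_NormedModule)); [apply continuous_sin | apply continuous_id].
  - rewrite sin_0, !Rminus_0_r in H. rewrite H, Rabs_mult.
    pose proof (one_sub_cos_bound c) as H1.
    assert (Hcy : Rabs c <= Rabs y).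
    { revert Hc. unfold Rmin, Rmax. destruct (Rle_dec 0 y); intros; unfold Rabs;
      destruct (Rcase_abs c), (Rcase_abs y); lra. }
    assert (c * c = Rabs c * Rabs c) by (rewrite <- Rabs_mult; rewrite Rabs_pos_eq; nra).
    assert (y * y = Rabs y * Rabs y) by (rewrite <- Rabs_mult; rewrite Rabs_pos_eq; nra).
    pose proof (Rabs_pos c). pose proof (Rabs_pos y). nra.
Qed.

Lemma Cmod_le_abs (w : C) : Cmod w <= Rabs (fst w) + Rabs (snd w).
Proof.
  pose proof (Cmod2_alt w) as H. unfold Re, Im in H.
  pose proof (Rabs_pos (fst w)). pose proof (Rabs_pos (snd w)).
  rewrite <- (pow2_abs (fst w)), <- (pow2_abs (snd w)) in H.
  pose proof (Cmod_ge_0 w). nra.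
Qed.

Lemma abs_fst_le_Cmod (w : C) : Rabs (fst w) <= Cmod w.
Proof. eapply Rle_trans; [apply Rmax_l | apply Rmax_Cmod]. Qed.

Lemma abs_snd_le_Cmod (w : C) : Rabs (snd w) <= Cmod w.
Proof. eapply Rle_trans; [apply Rmax_r | apply Rmax_Cmod]. Qed.

Lemma cder_cexp_0 : cder cexp 0 1.
Proof.
  (* Each coordinate of the remainder is at most [4 * c^2], so [8 * c <= e] is enough; [/2] is the
     range of [exp_sub_1_bound]. *)
  intros e He. exists (Rmin (/2) (e / 12)). split; [apply Rmin_pos; lra|].
  intros h Hh.
  pose proof (Rmin_l (/2) (e / 12)). pose proof (Rmin_r (/2) (e / 12)).
  replace (0 + h)%C with h by ring. rewrite cexp_0.
  pose proof (abs_fst_le_Cmod h) as Hx. pose proof (abs_snd_le_Cmod h) as Hy.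
  destruct h as [x y]. simpl fst in *. simpl snd in *.
  set (c := Cmod (x, y)) in *.
  (* Grouped so that every summand is of second order in [(x, y)]. *)
  replace (cexp (x, y) - 1 - 1 * (x, y))%C with
    ((exp x - 1 - x) * cos y + (1 + x) * (cos y - 1), (exp x - 1 - x) * sin y + x * sin y + (sin y - y)).
  2:{ unfold cexp, Cminus, Cplus, Copp, Cmult, RtoC. simpl. f_equal; ring. }
  eapply Rle_trans; [apply Cmod_le_abs|]. simpl.
  pose proof (exp_sub_1_bound x ltac:(lra)) as E1.
  pose proof (one_sub_cos_bound y) as E2.
  pose proof (sin_sub_bound y ltac:(lra)) as E3.
  pose proof (sin_bound y) as E4.
  assert (E5 : Rabs (cos y) <= 1) by (pose proof (COS_bound y); apply Rabs_le; lra).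
  assert (E6 : Rabs (sin y) <= 1) by (pose proof (SIN_bound y); apply Rabs_le; lra).
  assert (Rabs (1 + x) <= 2).
  { eapply Rle_trans; [apply Rabs_triang|]. rewrite Rabs_R1. lra. }
  assert (xx : x * x <= c * c).
  { assert (x * x = Rabs x * Rabs x) by (rewrite <- Rabs_mult; rewrite Rabs_pos_eq; nra).
    pose proof (Rabs_pos x). nra. }
  assert (yy : y * y <= c * c).
  { assert (y * y = Rabs y * Rabs y) by (rewrite <- Rabs_mult; rewrite Rabs_pos_eq; nra).
    pose proof (Rabs_pos y). nra. }
  pose proof (Rabs_pos (exp x - 1 - x)). pose proof (Rabs_pos (cos y - 1)).
  pose proof (Rabs_pos x). pose proof (Rabs_pos y). pose proof (Rabs_pos (sin y)).
  pose proof (Rabs_pos (cos y)). pose proof (Rabs_pos (1 + x)).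
  assert (B1 : Rabs ((exp x - 1 - x) * cos y + (1 + x) * (cos y - 1)) <= 4 * (c * c)).
  { eapply Rle_trans; [apply Rabs_triang|]. rewrite !Rabs_mult. nra. }
  assert (B2 : Rabs ((exp x - 1 - x) * sin y + x * sin y + (sin y - y)) <= 4 * (c * c)).
  { eapply Rle_trans; [apply Rabs_triang|].
    eapply Rle_trans; [apply Rplus_le_compat_r, Rabs_triang|]. rewrite !Rabs_mult.
    assert (Rabs x * Rabs (sin y) <= c * c) by nra. nra. }
  assert (0 <= c) by apply Cmod_ge_0. nra.
Qed.

Lemma cder_cexp (p : C) : cder cexp p (cexp p).
Proof.
  intros e He. assert (Hp : 0 < Cmod (cexp p)) by (rewrite Cmod_cexp; apply exp_pos).
  destruct (cder_cexp_0 (e / Cmod (cexp p))) as [d [Hd H]]; [now apply Rdiv_lt_0_compat|].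
  exists d. split; auto. intros h Hh. specialize (H h Hh).
  replace (0 + h)%C with h in H by ring. rewrite cexp_0 in H.
  rewrite cexp_plus.
  replace (cexp p * cexp h - cexp p - cexp p * h)%C with (cexp p * (cexp h - 1 - 1 * h))%C by ring.
  rewrite Cmod_mult.
  replace (e * Cmod h) with (Cmod (cexp p) * (e / Cmod (cexp p) * Cmod h)) by (field; lra).
  apply Rmult_le_compat_l; lra.
Qed.

(** * Goursat's theorem on rectangles *)

Definition holo_on (D : C -> Prop) (F : C -> C) : Prop :=
  forall p, D p -> exists l, cder F p l.

Definition rect (x1 x2 y1 y2 : R) (w : C) : Prop :=
  x1 <= fst w <= x2 /\ y1 <= snd w <= y2.

(** This is the imaginary part of the counterclockwise boundary integral of [K dw]. It suffices for
    the estimates, because a rotation of [K] brings the quantity of interest into this part. *)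
Definition rect_defect (K : C -> C) (x1 x2 y1 y2 : R) : R :=
  (RInt (fun y => fst (K (x2, y))) y1 y2 - RInt (fun y => fst (K (x1, y))) y1 y2)
  - (RInt (fun x => snd (K (x, y2))) x1 x2 - RInt (fun x => snd (K (x, y1))) x1 x2).

Lemma continuous_of_eps (g : R -> R) (x : R) :
  (forall e, 0 < e -> exists d, 0 < d /\ forall h, Rabs h < d -> Rabs (g (x + h) - g x) < e) ->
  continuous g x.
Proof.
  intros H. apply filterlim_locally. intros e.
  destruct (H e (cond_pos e)) as [d [Hd H1]]. exists (mkposreal d Hd).
  intros y Hy. change (Rabs (y - x) < d) in Hy. change (Rabs (g y - g x) < e).
  replace y with (x + (y - x)) at 1 by ring. auto.
Qed.

Lemma cder_continuous_vert (K : C -> C) (x y : R) (l : C) : cder K (x, y) l ->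
  continuous (fun t => fst (K (x, t))) y /\ continuous (fun t => snd (K (x, t))) y.
Proof.
  intros H. pose proof (cder_cont _ _ _ H) as Hc.
  split; apply continuous_of_eps; intros e He; destruct (Hc e He) as [d [Hd H1]];
    exists d; split; auto; intros h Hh.
  all: specialize (H1 (0, h)); assert (Hm : Cmod (0, h) < d)
    by (eapply Rle_lt_trans; [apply Cmod_le_abs|]; simpl; rewrite Rabs_R0; lra);
    specialize (H1 Hm);
    replace ((x, y) + (0, h))%C with (x, y + h) in H1
      by (unfold Cplus; simpl; f_equal; ring).
  - eapply Rle_lt_trans; [|exact H1].
    apply (abs_fst_le_Cmod (K (x, (y + h)%R) - K (x, y))%C).
  - eapply Rle_lt_trans; [|exact H1].
    apply (abs_snd_le_Cmod (K (x, (y + h)%R) - K (x, y))%C).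
Qed.

Lemma cder_continuous_horiz (K : C -> C) (x y : R) (l : C) : cder K (x, y) l ->
  continuous (fun t => snd (K (t, y))) x.
Proof.
  intros H. pose proof (cder_cont _ _ _ H) as Hc.
  apply continuous_of_eps; intros e He; destruct (Hc e He) as [d [Hd H1]];
    exists d; split; auto; intros h Hh.
  specialize (H1 (h, 0)). assert (Hm : Cmod (h, 0) < d)
    by (eapply Rle_lt_trans; [apply Cmod_le_abs|]; simpl; rewrite Rabs_R0; lra).
  specialize (H1 Hm).
  replace ((x, y) + (h, 0))%C with (x + h, y) in H1
      by (unfold Cplus; simpl; f_equal; ring).
  eapply Rle_lt_trans; [|exact H1].
  apply (abs_snd_le_Cmod (K ((x + h)%R, y) - K (x, y))%C).
Qed.

Lemma holo_ex_RInt_vert (K : C -> C) (x1 x2 y1 y2 x a b : R) :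
  holo_on (rect x1 x2 y1 y2) K -> x1 <= x <= x2 -> y1 <= a -> a <= b -> b <= y2 ->
  ex_RInt (fun y => fst (K (x, y))) a b.
Proof.
  intros H Hx Ha Hab Hb. apply (ex_RInt_continuous (V := R_CompleteNormedModule)).
  rewrite Rmin_left, Rmax_right by auto. intros z Hz.
  destruct (H (x, z)) as [l Hl]; [split; simpl; lra|].
  apply (cder_continuous_vert K x z l Hl).
Qed.

Lemma holo_ex_RInt_horiz (K : C -> C) (x1 x2 y1 y2 y a b : R) :
  holo_on (rect x1 x2 y1 y2) K -> y1 <= y <= y2 -> x1 <= a -> a <= b -> b <= x2 ->
  ex_RInt (fun x => snd (K (x, y))) a b.
Proof.
  intros H Hy Ha Hab Hb. apply (ex_RInt_continuous (V := R_CompleteNormedModule)).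
  rewrite Rmin_left, Rmax_right by auto. intros z Hz.
  destruct (H (z, y)) as [l Hl]; [split; simpl; lra|].
  apply (cder_continuous_horiz K z y l Hl).
Qed.

Lemma rect_sub (K : C -> C) (x1 x2 y1 y2 a1 a2 b1 b2 : R) :
  holo_on (rect x1 x2 y1 y2) K -> x1 <= a1 -> a2 <= x2 -> y1 <= b1 -> b2 <= y2 ->
  holo_on (rect a1 a2 b1 b2) K.
Proof. intros H ? ? ? ? p [? ?]. apply H. split; lra. Qed.

Lemma rect_defect_split_x (K : C -> C) (x1 xm x2 y1 y2 : R) :
  holo_on (rect x1 x2 y1 y2) K -> x1 <= xm <= x2 -> y1 <= y2 ->
  rect_defect K x1 x2 y1 y2 = rect_defect K x1 xm y1 y2 + rect_defect K xm x2 y1 y2.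
Proof.
  intros H Hx Hy. unfold rect_defect.
  rewrite <- (RInt_Chasles (fun x => snd (K (x, y1))) x1 xm x2)
    by (eapply holo_ex_RInt_horiz; eauto; lra).
  rewrite <- (RInt_Chasles (fun x => snd (K (x, y2))) x1 xm x2)
    by (eapply holo_ex_RInt_horiz; eauto; lra).
  unfold plus; simpl. ring.
Qed.

Lemma rect_defect_split_y (K : C -> C) (x1 x2 y1 ym y2 : R) :
  holo_on (rect x1 x2 y1 y2) K -> y1 <= ym <= y2 -> x1 <= x2 ->
  rect_defect K x1 x2 y1 y2 = rect_defect K x1 x2 y1 ym + rect_defect K x1 x2 ym y2.
Proof.
  intros H Hx Hy. unfold rect_defect.
  rewrite <- (RInt_Chasles (fun y => fst (K (x1, y))) y1 ym y2)
    by (eapply holo_ex_RInt_vert; eauto; lra).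
  rewrite <- (RInt_Chasles (fun y => fst (K (x2, y))) y1 ym y2)
    by (eapply holo_ex_RInt_vert; eauto; lra).
  unfold plus; simpl. ring.
Qed.

Lemma RInt_near_affine (g : R -> R) (a b c q m : R) :
  a <= b -> ex_RInt g a b -> (forall t, a <= t <= b -> Rabs (g t - (c + q * t)) <= m) ->
  Rabs (RInt g a b - (c * (b - a) + q * (b * b - a * a) / 2)) <= (b - a) * m.
Proof.
  intros Hab Hg Hm.
  assert (HA : is_RInt (fun t => c + q * t) a b (c * (b - a) + q * (b * b - a * a) / 2)).
  { replace (c * (b - a) + q * (b * b - a * a) / 2) with
      (minus (c * b + q * (b * b) / 2) (c * a + q * (a * a) / 2))
      by (unfold minus, plus, opp; simpl; field).
    apply (is_RInt_derive (V := R_CompleteNormedModule) (fun t => c * t + q * (t * t) / 2)).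
    - intros x _. auto_derive; auto. field.
    - intros x _. apply (ex_derive_continuous (K := R_AbsRing) (V := R_NormedModule)).
      auto_derive; auto. }
  rewrite <- (is_RInt_unique _ _ _ _ HA).
  assert (HA' : ex_RInt (fun t => c + q * t) a b) by (eexists; exact HA).
  pose proof (RInt_minus (V := R_CompleteNormedModule) g (fun t => c + q * t) a b Hg HA') as E.
  unfold minus, plus, opp in E. simpl in E. unfold Rminus. rewrite <- E.
  apply abs_RInt_le_const; auto.
  apply (ex_RInt_minus (V := R_NormedModule) g (fun t => c + q * t)); auto.
Qed.

(* On a rectangle close to a point of differentiability, [K] is nearly affine,
   and the defect of an affine function vanishes by the Cauchy-Riemann equations. *)
Lemma rect_defect_small (K : C -> C) (x1 x2 y1 y2 m : R) (p k l : C) :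
  holo_on (rect x1 x2 y1 y2) K -> x1 <= x2 -> y1 <= y2 ->
  (forall w, rect x1 x2 y1 y2 w -> Cmod (K w - k - l * (w - p)) <= m) ->
  Rabs (rect_defect K x1 x2 y1 y2) <= 2 * ((x2 - x1) + (y2 - y1)) * m.
Proof.
  intros H Hx Hy Hm.
  destruct p as [p q], k as [k k'], l as [l l'].
  assert (HU : forall x, x1 <= x <= x2 ->
    Rabs (RInt (fun y => fst (K (x, y))) y1 y2 -
      ((k + l * (x - p) + l' * q) * (y2 - y1) + (- l') * (y2 * y2 - y1 * y1) / 2)) <= (y2 - y1) * m).
  { intros x Hxx. apply RInt_near_affine; auto.
    - eapply holo_ex_RInt_vert; eauto; lra.
    - intros t Ht. eapply Rle_trans; [|apply (Hm (x, t)); split; simpl; lra].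
      eapply Rle_trans; [|apply abs_fst_le_Cmod].
      apply Req_le. f_equal. destruct (K (x, t)). simpl. ring. }
  assert (HV : forall y, y1 <= y <= y2 ->
    Rabs (RInt (fun x => snd (K (x, y))) x1 x2 -
      ((k' + l * (y - q) - l' * p) * (x2 - x1) + l' * (x2 * x2 - x1 * x1) / 2)) <= (x2 - x1) * m).
  { intros y Hyy. apply RInt_near_affine; auto.
    - eapply holo_ex_RInt_horiz; eauto; lra.
    - intros t Ht. eapply Rle_trans; [|apply (Hm (t, y)); split; simpl; lra].
      eapply Rle_trans; [|apply abs_snd_le_Cmod].
      apply Req_le. f_equal. destruct (K (t, y)). simpl. ring. }
  pose proof (HU x1 ltac:(lra)) as A1. pose proof (HU x2 ltac:(lra)) as A2.
  pose proof (HV y1 ltac:(lra)) as A3. pose proof (HV y2 ltac:(lra)) as A4.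
  (* The main terms of the vertical and of the horizontal difference are both
     [l * (x2 - x1) * (y2 - y1)] and cancel; four error terms remain. *)
  apply Rabs_le_between in A1, A2, A3, A4. unfold rect_defect.
  apply Rabs_le. nra.
Qed.

Lemma nested_intervals (u v : nat -> R) :
  (forall n, u n <= u (S n)) -> (forall n, v (S n) <= v n) -> (forall n, u n <= v n) ->
  exists x, forall n, u n <= x <= v n.
Proof.
  intros Hu Hv Huv.
  assert (Iu : forall n k, u n <= u (n + k)%nat).
  { intros n k. induction k. rewrite Nat.add_0_r; lra. rewrite Nat.add_succ_r.
    eapply Rle_trans; [exact IHk | apply Hu]. }
  assert (Iv : forall n k, v (n + k)%nat <= v n).
  { intros n k. induction k. rewrite Nat.add_0_r; lra. rewrite Nat.add_succ_r.
    eapply Rle_trans; [apply Hv | exact IHk]. }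
  assert (Hmn : forall m n, u m <= v n).
  { intros m n. eapply Rle_trans; [apply (Iu m n)|]. rewrite Nat.add_comm.
    eapply Rle_trans; [apply Huv|]. apply Iv. }
  destruct (completeness (fun x => exists n, x = u n)) as [x [Hub Hl]].
  - exists (v 0%nat). intros y [n ->]. auto.
  - exists (u 0%nat), 0%nat. auto.
  - exists x. intros n. split; [apply Hub; eauto|].
    apply Hl. intros y [m ->]. auto.
Qed.

Section Quadrisection.
Variables (K : C -> C) (a b : R).

Let D (n : nat) (q : R * R) : R :=
  rect_defect K (fst q) (fst q + a * (/ 2) ^ n) (snd q) (snd q + b * (/ 2) ^ n).

(** Only the lower left corner is carried along, since the generation [n] fixes the sides. The last
    quarter needs no test: if the other three each carry less than a fourth of the defect, it
    carries at least a fourth. *)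
Definition quad_step (n : nat) (q : R * R) : R * R :=
  let q1 := q in
  let q2 := (fst q + a * (/ 2) ^ (S n), snd q) in
  let q3 := (fst q, snd q + b * (/ 2) ^ (S n)) in
  let q4 := (fst q + a * (/ 2) ^ (S n), snd q + b * (/ 2) ^ (S n)) in
  if Rle_dec (Rabs (D n q)) (4 * Rabs (D (S n) q1)) then q1
  else if Rle_dec (Rabs (D n q)) (4 * Rabs (D (S n) q2)) then q2
  else if Rle_dec (Rabs (D n q)) (4 * Rabs (D (S n) q3)) then q3
  else q4.

Fixpoint quad_seq (q : R * R) (n : nat) : R * R :=
  match n with
  | O => q
  | S n => quad_step n (quad_seq q n)
  end.

Lemma quad_step_range (n : nat) (q : R * R) : 0 <= a -> 0 <= b ->
  (fst q <= fst (quad_step n q) <= fst q + a * (/ 2) ^ (S n)) /\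
  (snd q <= snd (quad_step n q) <= snd q + b * (/ 2) ^ (S n)).
Proof.
  intros Ha Hb.
  assert (0 < (/ 2) ^ (S n)) by (apply pow_lt; lra).
  assert (0 <= a * (/ 2) ^ (S n)) by (apply Rmult_le_pos; lra).
  assert (0 <= b * (/ 2) ^ (S n)) by (apply Rmult_le_pos; lra).
  unfold quad_step.
  repeat destruct Rle_dec; cbn [fst snd]; lra.
Qed.

Lemma quad_step_defect (n : nat) (q : R * R) : 0 <= a -> 0 <= b ->
  holo_on (rect (fst q) (fst q + a * (/ 2) ^ n) (snd q) (snd q + b * (/ 2) ^ n)) K ->
  Rabs (D n q) <= 4 * Rabs (D (S n) (quad_step n q)).
Proof.
  intros Ha Hb H. unfold quad_step.
  destruct Rle_dec as [h1|h1]; auto. destruct Rle_dec as [h2|h2]; auto.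
  destruct Rle_dec as [h3|h3]; auto.
  set (a' := a * (/ 2) ^ (S n)) in *. set (b' := b * (/ 2) ^ (S n)) in *.
  assert (Ea : a * (/ 2) ^ n = a' + a') by (unfold a'; simpl; field).
  assert (Eb : b * (/ 2) ^ n = b' + b') by (unfold b'; simpl; field).
  assert (0 < (/ 2) ^ (S n)) by (apply pow_lt; lra).
  assert (0 <= a') by (apply Rmult_le_pos; lra).
  assert (0 <= b') by (apply Rmult_le_pos; lra).
  unfold D in *. cbn [fst snd] in *. fold a' b' in h1, h2, h3 |- *. rewrite Ea, Eb in *.
  rewrite <- !Rplus_assoc in *.
  assert (E : rect_defect K (fst q) (fst q + a' + a') (snd q) (snd q + b' + b') =
    rect_defect K (fst q) (fst q + a') (snd q) (snd q + b') +
    rect_defect K (fst q + a') (fst q + a' + a') (snd q) (snd q + b') +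
    rect_defect K (fst q) (fst q + a') (snd q + b') (snd q + b' + b') +
    rect_defect K (fst q + a') (fst q + a' + a') (snd q + b') (snd q + b' + b')).
  { rewrite (rect_defect_split_x K _ (fst q + a')) by (auto; lra).
    rewrite (rect_defect_split_y K _ _ _ (snd q + b'))
      by (try (eapply rect_sub; eauto); lra).
    rewrite (rect_defect_split_y K (fst q + a') _ _ (snd q + b'))
      by (try (eapply rect_sub; eauto); lra).
    ring. }
  rewrite E in *. clear E.
  set (d1 := rect_defect K _ (fst q + a') (snd q) _) in *.
  set (d2 := rect_defect K (fst q + a') _ (snd q) _) in *.
  set (d3 := rect_defect K (fst q) (fst q + a') (snd q + b') _) in *.
  set (d4 := rect_defect K (fst q + a') _ (snd q + b') _) in *.
  pose proof (Rabs_triang (d1 + d2 + d3) d4). pose proof (Rabs_triang (d1 + d2) d3).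
  pose proof (Rabs_triang d1 d2). lra.
Qed.

Lemma quad_seq_spec (q : R * R) : 0 <= a -> 0 <= b ->
  holo_on (rect (fst q) (fst q + a) (snd q) (snd q + b)) K ->
  forall n,
    (fst q <= fst (quad_seq q n) /\ fst (quad_seq q n) + a * (/ 2) ^ n <= fst q + a) /\
    (snd q <= snd (quad_seq q n) /\ snd (quad_seq q n) + b * (/ 2) ^ n <= snd q + b) /\
    Rabs (D 0 q) <= 4 ^ n * Rabs (D n (quad_seq q n)).
Proof.
  intros Ha Hb H n. induction n as [|n IH].
  - simpl. lra.
  - destruct IH as [[i1 i2] [[i3 i4] i5]].
    cbn [quad_seq]. set (s := quad_seq q n) in *.
    destruct (quad_step_range n s Ha Hb) as [h1 h2].
    assert (Ea : a * (/ 2) ^ n = 2 * (a * (/ 2) ^ (S n))) by (simpl; field).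
    assert (Eb : b * (/ 2) ^ n = 2 * (b * (/ 2) ^ (S n))) by (simpl; field).
    repeat split; try lra.
    eapply Rle_trans; [exact i5|]. replace (4 ^ S n) with (4 ^ n * 4) by (simpl; ring).
    rewrite Rmult_assoc. apply Rmult_le_compat_l; [apply pow_le; lra|].
    apply quad_step_defect; auto. eapply rect_sub; eauto; lra.
Qed.

(** The nested quarters shrink to a point. Differentiability there bounds the defect of generation
    [n] by half-perimeter times deviation from an affine map, which is of order [e / 4^n]; this
    cancels the factor [4^n] gained by the selection. *)
Lemma goursat_aux (q : R * R) : 0 <= a -> 0 <= b ->
  holo_on (rect (fst q) (fst q + a) (snd q) (snd q + b)) K -> D 0 q = 0.
Proof.
  intros Ha Hb H. pose proof (quad_seq_spec q Ha Hb H) as S1.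
  assert (S2 : forall n, (fst (quad_seq q n) <= fst (quad_seq q (S n)) <=
                 fst (quad_seq q n) + a * (/ 2) ^ (S n)) /\
               (snd (quad_seq q n) <= snd (quad_seq q (S n)) <=
                 snd (quad_seq q n) + b * (/ 2) ^ (S n))).
  { intros n. cbn [quad_seq]. apply quad_step_range; auto. }
  assert (Hp : forall n, 0 < (/ 2) ^ n) by (intros; apply pow_lt; lra).
  assert (Ea : forall n, a * (/ 2) ^ n = 2 * (a * (/ 2) ^ (S n))) by (intros; simpl; field).
  assert (Eb : forall n, b * (/ 2) ^ n = 2 * (b * (/ 2) ^ (S n))) by (intros; simpl; field).
  destruct (nested_intervals (fun n => fst (quad_seq q n))
    (fun n => fst (quad_seq q n) + a * (/ 2) ^ n)) as [x Hx].
  { intros n. apply S2. }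
  { intros n. destruct (S2 n). rewrite (Ea n). lra. }
  { intros n. pose proof (Hp n). nra. }
  destruct (nested_intervals (fun n => snd (quad_seq q n))
    (fun n => snd (quad_seq q n) + b * (/ 2) ^ n)) as [y Hy].
  { intros n. apply S2. }
  { intros n. destruct (S2 n). rewrite (Eb n). lra. }
  { intros n. pose proof (Hp n). nra. }
  destruct (H (x, y)) as [l Hl].
  { specialize (Hx 0%nat). specialize (Hy 0%nat). split; simpl in *; lra. }
  assert (Hall : forall e, 0 < e -> Rabs (D 0 q) <= e * (2 * (a + b) * (a + b))).
  { intros e He. destruct (Hl e He) as [d [Hd H1]].
    assert (exists n, (a + b) * (/ 2) ^ n < d) as [n Hn].
    (* The summand 1 keeps the divisor positive for a degenerate rectangle. *)
    { destruct (pow_lt_1_zero (/ 2) ltac:(rewrite Rabs_pos_eq; lra) (d / (a + b + 1))) as [n Hn].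
      { apply Rdiv_lt_0_compat; lra. }
      exists n. specialize (Hn n (le_n n)). rewrite Rabs_pos_eq in Hn by (left; auto).
      apply Rlt_div_r in Hn; [|lra]. pose proof (Hp n). nra. }
    destruct (S1 n) as [[i1 i2] [[i3 i4] i5]].
    specialize (Hx n). specialize (Hy n). pose proof (Hp n) as Hpn.
    set (s := quad_seq q n) in *.
    assert (HD : Rabs (D n s) <= 2 * (a * (/ 2) ^ n + b * (/ 2) ^ n) * (e * ((a + b) * (/ 2) ^ n))).
    { unfold D.
      replace (a * (/ 2) ^ n + b * (/ 2) ^ n) with
        ((fst s + a * (/ 2) ^ n - fst s) + (snd s + b * (/ 2) ^ n - snd s)) by ring.
      apply rect_defect_small with (p := (x, y)) (k := K (x, y)) (l := l).
      - eapply rect_sub; eauto; lra.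
      - nra.
      - nra.
      - intros [u v] [Hu Hv]. simpl fst in *. simpl snd in *.
        assert (Hh : Cmod ((u, v) - (x, y)) <= (a + b) * (/ 2) ^ n).
        { eapply Rle_trans; [apply Cmod_le_abs|]. simpl.
          assert (Rabs (u + - x) <= a * (/ 2) ^ n) by (apply Rabs_le; lra).
          assert (Rabs (v + - y) <= b * (/ 2) ^ n) by (apply Rabs_le; lra). lra. }
        specialize (H1 ((u, v) - (x, y))%C ltac:(lra)).
        replace ((x, y) + ((u, v) - (x, y)))%C with (u, v) in H1
          by (unfold Cplus, Cminus, Copp; simpl; f_equal; ring).
        eapply Rle_trans; [exact H1|]. apply Rmult_le_compat_l; lra. }
    eapply Rle_trans; [exact i5|].
    assert (E4 : 4 ^ n * ((/ 2) ^ n * (/ 2) ^ n) = 1).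
    { rewrite <- !Rpow_mult_distr. replace (4 * (/ 2 * / 2)) with 1 by field. apply pow1. }
    assert (H4 : 0 <= 4 ^ n) by (apply pow_le; lra).
    eapply Rle_trans; [apply Rmult_le_compat_l; [exact H4 | exact HD]|].
    apply Req_le.
    replace (4 ^ n * (2 * (a * (/ 2) ^ n + b * (/ 2) ^ n) * (e * ((a + b) * (/ 2) ^ n))))
      with ((4 ^ n * ((/ 2) ^ n * (/ 2) ^ n)) * (e * (2 * (a + b) * (a + b)))) by ring.
    rewrite E4. ring. }
  destruct (Req_dec (D 0 q) 0) as [|Hne]; auto. exfalso.
  assert (Hpos : 0 < Rabs (D 0 q)) by now apply Rabs_pos_lt.
  assert (HB : 0 < 2 * (a + b) * (a + b) + 1) by nra.
  (* With this [e] the bound falls strictly below [Rabs (D 0 q)] itself. *)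
  specialize (Hall (Rabs (D 0 q) / (2 * (a + b) * (a + b) + 1)) ltac:(now apply Rdiv_lt_0_compat)).
  set (B := 2 * (a + b) * (a + b)) in *.
  assert (Rabs (D 0 q) / (B + 1) * (B + 1) = Rabs (D 0 q)) by (field; lra).
  assert (0 < Rabs (D 0 q) / (B + 1)) by now apply Rdiv_lt_0_compat.
  nra.
Qed.

End Quadrisection.

Lemma goursat (K : C -> C) (x1 x2 y1 y2 : R) : x1 <= x2 -> y1 <= y2 ->
  holo_on (rect x1 x2 y1 y2) K -> rect_defect K x1 x2 y1 y2 = 0.
Proof.
  intros Hx Hy H.
  pose proof (goursat_aux K (x2 - x1) (y2 - y1) (x1, y1)) as G. cbn [fst snd pow] in G.
  replace (x1 + (x2 - x1) * 1) with x2 in G by ring.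
  replace (y1 + (y2 - y1) * 1) with y2 in G by ring.
  replace (x1 + (x2 - x1)) with x2 in G by ring.
  replace (y1 + (y2 - y1)) with y2 in G by ring.
  apply G; auto; lra.
Qed.

(** * Cauchy estimates *)

Definition cdisk (p : C) (t : R) (w : C) : Prop := Cmod (w - p) <= t.

(** Turns a modulus into the real part of a rotated quantity, to which real integrals and the real
    mean value theorem apply. *)
Lemma unit_rotation (l : C) : exists u : C, Cmod u = 1 /\ (u * l)%C = RtoC (Cmod l).
Proof.
  destruct (Req_dec (Cmod l) 0) as [H|H].
  - exists 1. split; [apply Cmod_1|]. rewrite H, (Cmod_eq_0 _ H). ring.
  - exists (Cconj l / RtoC (Cmod l))%C.
    assert (RtoC (Cmod l) <> 0) by (intros E; apply H; now injection E).
    split.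
    + rewrite Cmod_div, Cmod_conj, Cmod_R, Rabs_pos_eq by (auto; apply Cmod_ge_0). field. auto.
    + replace (Cconj l / Cmod l * l)%C with ((l * Cconj l) / Cmod l)%C by (field; auto).
      rewrite <- Cmod2_conj. rewrite RtoC_pow. field. auto.
Qed.

Lemma cexp_opp (w : C) : cexp (- w) = (/ cexp w)%C.
Proof.
  replace (cexp (- w)) with (cexp (- w + w) * / cexp w)%C
    by (rewrite cexp_plus; field; apply cexp_neq_0).
  replace (- w + w)%C with (RtoC 0) by ring. rewrite cexp_0. ring.
Qed.

(* The function [w |-> G (p + e^w) e^(-w)] is holomorphic on [Re w <= ln t] and
   [2 PI i]-periodic, so its means over vertical segments of length [2 PI] agree;
   as [Re w] tends to [-oo] they tend to [l]. *)
Lemma cauchy_estimate_at_zero (G : C -> C) (p l : C) (t B : R) :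
  0 < t -> holo_on (cdisk p t) G -> G p = 0 -> cder G p l ->
  (forall w, Cmod (w - p) = t -> Cmod (G w) <= B) -> Cmod l <= B / t.
Proof.
  intros Ht H Hz Hl HB.
  destruct (unit_rotation l) as [u [Hu Hul]].
  (* The factor [u] makes the limit of the means the real number [Cmod l]. *)
  set (K := fun w : C => (u * G (p + cexp w) * cexp (- w))%C).
  assert (HK : forall s1, holo_on (rect s1 (ln t) 0 (2 * PI)) K).
  { intros s1 w [Hw _].
    destruct (H (p + cexp w)%C) as [m Hm].
    { unfold cdisk. replace (p + cexp w - p)%C with (cexp w) by ring. rewrite Cmod_cexp.
      rewrite <- (exp_ln t Ht). destruct (Rle_lt_or_eq_dec _ _ (proj2 Hw)) as [h|h].
      left; now apply exp_increasing. rewrite h; lra. }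
    eexists. unfold K. apply cder_mult.
    - apply cder_mult. apply (cder_ext (fun w => 0 * w + u)%C _ _ 0 0); [intros; ring|auto|apply cder_affine].
      apply (cder_comp G (fun w => p + cexp w)%C).
      + apply cder_plus; [|apply cder_cexp].
        apply (cder_ext (fun w => 0 * w + p)%C _ _ 0 0); [intros; ring|auto|apply cder_affine].
      + exact Hm.
    - apply (cder_comp cexp (fun w => - w)%C).
      + apply (cder_ext (fun w => (- (1)) * w + 0)%C _ _ (- (1))%C (- (1))%C);
          [intros; ring|auto|apply cder_affine].
      + apply cder_cexp. }
  assert (Hper : forall x, K (x, 2 * PI) = K (x, 0)).
  { intros x. unfold K. 
    replace (cexp (x, 2 * PI)) with (cexp (x, 0))
      by (unfold cexp; cbn [fst snd]; now rewrite cos_2PI, sin_2PI, cos_0, sin_0).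
    replace (cexp (- (x, 2 * PI))) with (cexp (- (x, 0)))
      by (unfold cexp, Copp; cbn [fst snd];
          now rewrite Ropp_0, cos_neg, sin_neg, cos_2PI, sin_2PI, cos_0, sin_0, Ropp_0).
    reflexivity. }
  pose proof PI_RGT_0 as Hpi.
  (* By periodicity the two horizontal sides cancel in the defect. *)
  assert (Hmean : forall s1, s1 <= ln t ->
    RInt (fun y => fst (K (ln t, y))) 0 (2 * PI) = RInt (fun y => fst (K (s1, y))) 0 (2 * PI)).
  { intros s1 Hs. pose proof (goursat K s1 (ln t) 0 (2 * PI) Hs ltac:(lra) (HK s1)) as G0.
    unfold rect_defect in G0.
    rewrite (RInt_ext (V := R_CompleteNormedModule)
      (fun x => snd (K (x, 2 * PI))) (fun x => snd (K (x, 0)))) in G0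
      by (intros; now rewrite Hper). lra. }
  assert (Hup : RInt (fun y => fst (K (ln t, y))) 0 (2 * PI) <= (2 * PI) * (B / t)).
  { eapply Rle_trans; [apply Rle_abs|].
    replace (2 * PI) with (2 * PI - 0) at 2 by ring.
    apply abs_RInt_le_const; [lra| |].
    - eapply holo_ex_RInt_vert; [exact (HK (ln t))| | | |]; lra.
    - intros y _. eapply Rle_trans; [apply abs_fst_le_Cmod|].
      unfold K. rewrite !Cmod_mult, Hu, Cmod_cexp. cbn [fst Copp].
      rewrite exp_Ropp, exp_ln by auto. rewrite Rmult_1_l.
      apply Rmult_le_compat_r; [left; now apply Rinv_0_lt_compat|].
      apply HB. replace (p + cexp (ln t, y) - p)%C with (cexp (ln t, y)) by ring.
      rewrite Cmod_cexp. cbn [fst]. now apply exp_ln. }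
  apply le_epsilon. intros e He.
  destruct (Hl e He) as [d [Hd H1]].
  (* The left side must correspond to a circle of radius below [d], and must not pass the right
     side. *)
  set (s1 := Rmin (ln t) (ln (d / 2))).
  assert (Hs1 : exp s1 < d).
  { apply Rle_lt_trans with (d / 2); [|lra]. rewrite <- (exp_ln (d / 2)) by lra.
    destruct (Rle_lt_or_eq_dec _ _ (Rmin_r (ln t) (ln (d / 2)))) as [h|h].
    left; now apply exp_increasing. unfold s1; rewrite h; lra. }
  assert (Hlow : (2 * PI) * (Cmod l - e) <= RInt (fun y => fst (K (s1, y))) 0 (2 * PI)).
  { replace ((2 * PI) * (Cmod l - e)) with (RInt (fun _ => Cmod l - e) 0 (2 * PI))
      by (rewrite RInt_const; unfold scal; simpl; unfold mult; simpl; ring).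
    apply RInt_le; [lra|apply ex_RInt_const| |].
    - eapply holo_ex_RInt_vert; [exact (HK s1)| | | |]; try lra.
      split; [lra|apply Rmin_l].
    - intros y _.
      assert (Hc : Cmod (cexp (s1, y)) = exp s1) by apply Cmod_cexp.
      specialize (H1 (cexp (s1, y)) ltac:(lra)). rewrite Hz in H1.
      assert (E := cexp_opp (s1, y)).
      assert (E2 : Cmod (K (s1, y) - Cmod l)%C <= e).
      { unfold K. rewrite E, <- Hul.
        replace (u * G (p + cexp (s1, y)) * / cexp (s1, y) - u * l)%C with
          (u * ((G (p + cexp (s1, y))%C - 0 - l * cexp (s1, y)) / cexp (s1, y)))%C
          by (field; apply cexp_neq_0).
        rewrite Cmod_mult, Hu, Rmult_1_l, Cmod_div by apply cexp_neq_0.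
        apply Rle_div_l; [rewrite Hc; apply exp_pos|exact H1]. }
      pose proof (abs_fst_le_Cmod (K (s1, y) - Cmod l)%C) as E3.
      change (fst (K (s1, y) - Cmod l)%C) with (fst (K (s1, y)) + - Cmod l) in E3.
      assert (E4 := Rle_trans _ _ _ E3 E2). apply Rabs_le_between in E4. lra. }
  rewrite <- (Hmean s1 (Rmin_l _ _)) in Hlow.
  assert (2 * PI * (Cmod l - e) <= 2 * PI * (B / t)) by lra.
  apply Rplus_le_reg_r with (- e). apply Rmult_le_reg_l with (2 * PI); lra.
Qed.

Lemma cder_id_sub (p q : C) : cder (fun w => w - p)%C q 1.
Proof.
  apply (cder_ext (fun w => 1 * w + - p)%C _ _ 1 1); [intros; ring|auto|apply cder_affine].
Qed.

(** The function [(w - p) F(w)] vanishes at [p] with derivative [F p], and is bounded by [t * B] on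
    the circle. *)
Lemma max_principle_center (F : C -> C) (p : C) (t B : R) :
  0 < t -> holo_on (cdisk p t) F ->
  (forall w, Cmod (w - p) = t -> Cmod (F w) <= B) -> Cmod (F p) <= B.
Proof.
  intros Ht H HB.
  assert (Hp : cdisk p t p) by (unfold cdisk; replace (p - p)%C with (RtoC 0) by ring; rewrite Cmod_0; lra).
  replace B with ((t * B) / t) by (field; lra).
  apply (cauchy_estimate_at_zero (fun w => (w - p) * F w)%C p); auto.
  - intros q Hq. destruct (H q Hq) as [m Hm]. eexists.
    apply cder_mult; [apply cder_id_sub | exact Hm].
  - ring.
  - destruct (H p Hp) as [m Hm].
    eapply cder_ext; [| |apply (cder_mult (fun w => w - p)%C F p 1 m); [apply (cder_id_sub p) | exact Hm]].
    intros; reflexivity. ring.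
  - intros w Hw. rewrite Cmod_mult, Hw. apply Rmult_le_compat_l; [lra|auto].
Qed.

(** Applied to [F - F p], which vanishes at [p]; the factor 2 pays for bounding [F p] by the maximum
    principle. *)
Lemma cauchy_estimate (F : C -> C) (p l : C) (t B : R) :
  0 < t -> holo_on (cdisk p t) F -> cder F p l ->
  (forall w, Cmod (w - p) = t -> Cmod (F w) <= B) -> Cmod l <= 2 * B / t.
Proof.
  intros Ht H Hl HB.
  pose proof (max_principle_center F p t B Ht H HB) as Hc.
  apply (cauchy_estimate_at_zero (fun w => F w - F p)%C p); auto.
  - intros q Hq. destruct (H q Hq) as [m Hm]. exists m.
    eapply cder_ext; [| |apply (cder_plus F (fun w => 0 * w + - F p)%C q m 0);
      [exact Hm | apply cder_affine]]; [intros; simpl; ring | ring].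
  - ring.
  - eapply cder_ext; [| |apply (cder_plus F (fun w => 0 * w + - F p)%C p l 0);
      [exact Hl | apply cder_affine]]; [intros; simpl; ring | ring].
  - intros w Hw. unfold Cminus. eapply Rle_trans; [apply Cmod_triangle|].
    rewrite Cmod_opp. specialize (HB w Hw). lra.
Qed.

Lemma cder_real_line (F : C -> C) (u p l : C) (x : R) :
  cder F (p + RtoC x)%C l -> is_derive (fun y => fst (u * F (p + RtoC y))%C) x (fst (u * l)%C).
Proof.
  intros H. apply is_derive_Reals. intros e He.
  set (c := Cmod u + 1). assert (Hc : 0 < c) by (pose proof (Cmod_ge_0 u); unfold c; lra).
  destruct (H (e / (2 * c)) ltac:(apply Rdiv_lt_0_compat; lra)) as [d [Hd H1]].
  exists (mkposreal d Hd). intros h Hh Hhd. simpl in Hhd.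
  specialize (H1 (RtoC h)). rewrite Cmod_R in H1. specialize (H1 Hhd).
  replace (p + x + h)%C with (p + RtoC (x + h))%C in H1 by (rewrite RtoC_plus; ring).
  assert (Hh' : 0 < Rabs h) by now apply Rabs_pos_lt.
  assert (E : (fst (u * F (p + RtoC (x + h)))%C - fst (u * F (p + x))%C) / h - fst (u * l)%C =
    fst (u * (F (p + RtoC (x + h))%C - F (p + x)%C - l * h))%C / h).
  { destruct u, l, (F (p + RtoC (x + h))%C), (F (p + x)%C). simpl. field. auto. }
  rewrite E. rewrite Rabs_div by auto. apply Rlt_div_l; auto.
  eapply Rle_lt_trans; [apply abs_fst_le_Cmod|]. rewrite Cmod_mult.
  apply Rle_lt_trans with (c * (e / (2 * c) * Rabs h)).
  - apply Rmult_le_compat; auto; try apply Cmod_ge_0. unfold c; lra.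
  - replace (c * (e / (2 * c) * Rabs h)) with (e / 2 * Rabs h) by (field; lra). nra.
Qed.

(** After the rotation that makes the total increment of [F] real, the increment is that of a real
    function of [y]. Horizontal segments are enough, since the end point will be any point of a free
    circle about [p]. *)
Lemma mean_value_real_line (F : C -> C) (p : C) (x L : R) : 0 <= x ->
  (forall y, 0 <= y <= x -> exists l, cder F (p + RtoC y)%C l /\ Cmod l <= L) ->
  Cmod (F (p + RtoC x)%C - F p)%C <= L * x.
Proof.
  intros Hx H.
  destruct (unit_rotation (F (p + RtoC x)%C - F p)%C) as [u [Hu Hul]].
  set (g := fun y => fst (u * F (p + RtoC y))%C).
  assert (Hd : forall y, 0 <= y <= x -> exists m, is_derive g y m /\ Rabs m <= L).
  { intros y Hy. destruct (H y Hy) as [l [Hl Hb]]. exists (fst (u * l)%C). split.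
    - now apply cder_real_line.
    - eapply Rle_trans; [apply abs_fst_le_Cmod|]. rewrite Cmod_mult, Hu. lra. }
  assert (E : Cmod (F (p + RtoC x)%C - F p)%C = g x - g 0).
  { unfold g. replace (p + 0)%C with p by ring.
    assert (E1 := f_equal fst Hul). cbn [fst RtoC] in E1. rewrite <- E1.
    destruct u, (F (p + RtoC x)%C), (F p). simpl. ring. }
  rewrite E.
  destruct (MVT_gen g 0 x (Derive g)) as [c [Hc Hm]].
  - rewrite Rmin_left, Rmax_right by auto. intros y Hy.
    destruct (Hd y ltac:(lra)) as [m [Hm _]]. apply Derive_correct. eexists; eauto.
  - rewrite Rmin_left, Rmax_right by auto. intros y Hy.
    destruct (Hd y ltac:(lra)) as [m [Hm _]]. apply continuity_pt_filterlim.
    apply (ex_derive_continuous (K := R_AbsRing) (V := R_NormedModule)). eexists; eauto.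
  - rewrite Rmin_left, Rmax_right in Hc by auto.
    destruct (Hd c Hc) as [m [Hm1 Hm2]]. rewrite (is_derive_unique _ _ _ Hm1) in Hm.
    rewrite Hm. apply Rabs_le_between in Hm2. nra.
Qed.

(** * Expansion of [|w|^rho] *)

(** One integration by the mean value theorem, raising the order of vanishing at 0 by one. *)
Lemma bound_of_derive_bound (g g' : R -> R) (A K : R) (n : nat) : 0 <= K ->
  (forall v, Rabs v <= A -> is_derive g v (g' v)) ->
  (forall v, Rabs v <= A -> Rabs (g' v) <= K * Rabs v ^ n) -> g 0 = 0 ->
  forall v, Rabs v <= A -> Rabs (g v) <= K * Rabs v ^ S n.
Proof.
  intros HK Hd Hb H0 v Hv.
  assert (Hin : forall x, Rmin 0 v <= x <= Rmax 0 v -> Rabs x <= Rabs v).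
  { intros x. unfold Rmin, Rmax. destruct (Rle_dec 0 v); intros; unfold Rabs;
      destruct (Rcase_abs x), (Rcase_abs v); lra. }
  destruct (MVT_gen g 0 v g') as [c [Hc E]].
  - intros x Hx. apply Hd. eapply Rle_trans; [apply Hin; lra|auto].
  - intros x Hx. apply continuity_pt_filterlim.
    apply (ex_derive_continuous (K := R_AbsRing) (V := R_NormedModule)). eexists.
    apply Hd. eapply Rle_trans; [apply Hin; lra|auto].
  - rewrite H0, !Rminus_0_r in E. rewrite E, Rabs_mult.
    assert (Hcv := Hin c Hc).
    replace (K * Rabs v ^ S n) with (K * Rabs v ^ n * Rabs v) by (simpl; ring).
    apply Rmult_le_compat_r; [apply Rabs_pos|].
    eapply Rle_trans; [apply Hb; lra|]. apply Rmult_le_compat_l; auto.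
    apply pow_incr. split; [apply Rabs_pos|auto].
Qed.

Lemma is_derive_Rpower_1p (c v : R) : -1 < v ->
  is_derive (fun v => Rpower (1 + v) c) v (c * Rpower (1 + v) (c - 1)).
Proof.
  intros Hv. unfold Rminus. rewrite Rpower_plus, Rpower_Ropp, Rpower_1 by lra.
  unfold Rpower. auto_derive; [lra|]. field. lra.
Qed.

Lemma Rpower_1p_bound (c v : R) : Rabs v <= / 2 -> Rpower (1 + v) c <= exp (Rabs c * ln 2).
Proof.
  intros Hv. apply Rabs_le_between in Hv. unfold Rpower.
  assert (Hl : Rabs (ln (1 + v)) <= ln 2).
  { apply Rabs_le. split.
    - rewrite <- ln_Rinv by lra. apply ln_le; lra.
    - apply ln_le; lra. }
  assert (H : c * ln (1 + v) <= Rabs c * ln 2).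
  { eapply Rle_trans; [apply Rle_abs|]. rewrite Rabs_mult.
    apply Rmult_le_compat_l; [apply Rabs_pos|auto]. }
  destruct H as [H| ->]; [left; now apply exp_increasing|lra].
Qed.

(** [K] bounds the third derivative on [[-1/2, 1/2]]. The remainder and its first two derivatives
    vanish at 0, so three integrations give the cubic bound. *)
Lemma Rpower_1p_taylor (b : R) : exists K, 0 <= K /\ forall v, Rabs v <= / 2 ->
  Rabs (Rpower (1 + v) b - (1 + b * v + b * (b - 1) / 2 * (v * v))) <= K * Rabs v ^ 3.
Proof.
  set (K := Rabs (b * (b - 1) * (b - 2)) * exp (Rabs (b - 3) * ln 2)).
  assert (HK : 0 <= K) by (apply Rmult_le_pos; [apply Rabs_pos|left; apply exp_pos]).
  exists K. split; auto.
  assert (Hv1 : forall v, Rabs v <= / 2 -> -1 < v) by (intros v Hv; apply Rabs_le_between in Hv; lra).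
  assert (R1 : forall c, Rpower (1 + 0) c = 1) by
    (intros c; rewrite Rplus_0_r; unfold Rpower; rewrite ln_1, Rmult_0_r; apply exp_0).
  apply (bound_of_derive_bound _ (fun v => b * (Rpower (1 + v) (b - 1) - (1 + (b - 1) * v))) (/2) K 2); auto.
  - intros v Hv. apply Hv1 in Hv.
    replace (b * (Rpower (1 + v) (b - 1) - (1 + (b - 1) * v))) with
      (minus (b * Rpower (1 + v) (b - 1)) (b + b * (b - 1) * v))
      by (unfold minus, plus, opp; simpl; ring).
    apply (is_derive_minus (K := R_AbsRing) (V := R_NormedModule)); [now apply is_derive_Rpower_1p|].
    auto_derive; auto. field.
  - apply (bound_of_derive_bound _ (fun v => b * (b - 1) * (Rpower (1 + v) (b - 2) - 1)) (/2) K 1); auto.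
    + intros v Hv. apply Hv1 in Hv.
      replace (b * (b - 1) * (Rpower (1 + v) (b - 2) - 1)) with
        (scal b (minus ((b - 1) * Rpower (1 + v) (b - 1 - 1)) (b - 1)))
        by (unfold minus, plus, opp, scal; simpl; unfold mult; simpl;
            replace (b - 1 - 1) with (b - 2) by ring; ring).
      apply is_derive_scal.
      apply (is_derive_minus (K := R_AbsRing) (V := R_NormedModule)); [now apply is_derive_Rpower_1p|].
      auto_derive; auto. ring.
    + apply (bound_of_derive_bound _ (fun v => b * (b - 1) * ((b - 2) * Rpower (1 + v) (b - 3))) (/2) K 0); auto.
      * intros v Hv. apply Hv1 in Hv.
        replace (b * (b - 1) * ((b - 2) * Rpower (1 + v) (b - 3))) with
          (scal (b * (b - 1)) (minus ((b - 2) * Rpower (1 + v) (b - 2 - 1)) 0))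
          by (unfold minus, plus, opp, scal; simpl; unfold mult; simpl;
            replace (b - 2 - 1) with (b - 3) by ring; ring).
        apply is_derive_scal.
        apply (is_derive_minus (K := R_AbsRing) (V := R_NormedModule)); [now apply is_derive_Rpower_1p|].
        apply (is_derive_const (K := R_AbsRing) (V := R_NormedModule)).
      * intros v Hv. simpl. rewrite Rmult_1_r.
        replace (b * (b - 1) * ((b - 2) * Rpower (1 + v) (b - 3))) with
          (b * (b - 1) * (b - 2) * Rpower (1 + v) (b - 3)) by ring.
        rewrite Rabs_mult. apply Rmult_le_compat_l; [apply Rabs_pos|].
        rewrite Rabs_pos_eq by (left; apply exp_pos). now apply Rpower_1p_bound.
      * rewrite R1. ring.
    + rewrite R1. ring.
  - rewrite R1. ring.
Qed.

(** Write [|1 + x|^rho = (1 + v)^(rho/2)] with [v = 2 Re x + |x|^2]. Since [(Re x)^2] is half of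
    [Re (x^2) + |x|^2], the second order part splits into a harmonic term and [rho^2/4 |x|^2]; the
    latter measures strict subharmonicity. *)
Lemma Rpower_Cmod_1p_expansion (rho : R) : exists K, 0 <= K /\ forall x : C, Cmod x <= / 8 ->
  Rabs (Rpower (Cmod (1 + x)) rho -
    (1 + fst (rho * x + rho * (rho - 2) / 4 * (x * x))%C + rho ^ 2 / 4 * Cmod x ^ 2))
  <= K * Cmod x ^ 3.
Proof.
  set (b := rho / 2).
  destruct (Rpower_1p_taylor b) as [K0 [HK0 HT]].
  (* The 27 comes from [Rabs v <= 3 * m], the second summand from the terms of order three and four
     in [v^2]. *)
  exists (27 * K0 + 3 * Rabs (b * (b - 1))). split.
  { pose proof (Rabs_pos (b * (b - 1))). lra. }
  intros x Hx.
  set (m := Cmod x) in *. assert (Hm : 0 <= m) by apply Cmod_ge_0.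
  assert (Hm2 : m ^ 2 = fst x ^ 2 + snd x ^ 2) by apply Cmod2_alt.
  pose proof (abs_fst_le_Cmod x) as Hfx. fold m in Hfx.
  set (v := 2 * fst x + m ^ 2).
  assert (Hv : Rabs v <= 3 * m).
  { apply Rabs_le. apply Rabs_le_between in Hfx. unfold v. nra. }
  assert (E1 : Cmod (1 + x) ^ 2 = 1 + v).
  { rewrite Cmod2_alt. unfold v, Re, Im. destruct x as [p q]. simpl in *. nra. }
  assert (Hv2 : -1 < v) by (apply Rabs_le_between in Hv; lra).
  assert (Hc : 0 < Cmod (1 + x)).
  { destruct (Cmod_ge_0 (1 + x)) as [h|h]; auto. rewrite <- h in E1. lra. }
  assert (E2 : Rpower (Cmod (1 + x)) rho = Rpower (1 + v) b).
  { rewrite <- E1. rewrite <- Rpower_pow by auto. rewrite Rpower_mult. f_equal.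
    unfold b. simpl. field. }
  rewrite E2.
  specialize (HT v ltac:(lra)).
  assert (E3 : 1 + fst (rho * x + rho * (rho - 2) / 4 * (x * x))%C + rho ^ 2 / 4 * m ^ 2 =
    1 + b * v + b * (b - 1) / 2 * (v * v) - b * (b - 1) / 2 * (4 * fst x * m ^ 2 + m ^ 4)).
  { replace (fst (rho * x + rho * (rho - 2) / 4 * (x * x))%C) with
      (rho * fst x + rho * (rho - 2) / 4 * (fst x ^ 2 - snd x ^ 2)).
    2:{ destruct x as [p q].
        replace (rho * (rho - 2) / 4)%C with (RtoC (rho * (rho - 2) / 4))
          by (rewrite RtoC_div, RtoC_mult, RtoC_minus by lra; reflexivity).
        simpl. field. }
    replace (snd x ^ 2) with (m ^ 2 - fst x ^ 2) by lra.
    unfold v, b. field. }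
  rewrite E3.
  assert (Hv3 : Rabs v ^ 3 <= 27 * m ^ 3).
  { replace (27 * m ^ 3) with ((3 * m) ^ 3) by ring. apply pow_incr. split; [apply Rabs_pos|auto]. }
  replace (Rpower (1 + v) b - (1 + b * v + b * (b - 1) / 2 * (v * v) -
    b * (b - 1) / 2 * (4 * fst x * m ^ 2 + m ^ 4))) with
    ((Rpower (1 + v) b - (1 + b * v + b * (b - 1) / 2 * (v * v))) +
     (b * (b - 1)) * ((4 * fst x * m ^ 2 + m ^ 4) / 2)) by field.
  eapply Rle_trans; [apply Rabs_triang|]. rewrite Rabs_mult.
  assert (H5 : Rabs ((4 * fst x * m ^ 2 + m ^ 4) / 2) <= 3 * m ^ 3).
  { assert (0 <= m ^ 2) by nra. assert (m ^ 4 <= m ^ 3) by (simpl; nra).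
    assert (Rabs (fst x) * m ^ 2 <= m ^ 3) by (simpl; nra).
    assert (Rabs (fst x * m ^ 2) <= m ^ 3).
    { rewrite Rabs_mult, (Rabs_pos_eq (m ^ 2)); auto. }
    apply Rabs_le_between in H2. assert (0 <= m ^ 4) by (simpl; nra).
    apply Rabs_le. nra. }
  pose proof (Rabs_pos (b * (b - 1))).
  assert (K0 * Rabs v ^ 3 <= K0 * (27 * m ^ 3)) by (apply Rmult_le_compat_l; auto).
  assert (Rabs (b * (b - 1)) * Rabs ((4 * fst x * m ^ 2 + m ^ 4) / 2) <= Rabs (b * (b - 1)) * (3 * m ^ 3))
    by (apply Rmult_le_compat_l; auto).
  lra.
Qed.

Lemma Rpower_Cmod_expansion (rho : R) : exists K, 0 <= K /\ forall a x : C,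
  a <> 0 -> Cmod x <= / 8 ->
  Rabs (Rpower (Cmod (a * (1 + x))) rho - Rpower (Cmod a) rho *
    (1 + fst (rho * x + rho * (rho - 2) / 4 * (x * x))%C + rho ^ 2 / 4 * Cmod x ^ 2))
  <= K * Rpower (Cmod a) rho * Cmod x ^ 3.
Proof.
  destruct (Rpower_Cmod_1p_expansion rho) as [K [HK H]]. exists K. split; auto.
  intros a x Ha Hx. specialize (H x Hx).
  assert (Hc : 0 < Cmod (1 + x)).
  { pose proof (Cmod_triangle_sub 1 (1 + x)) as H1.
    replace (1 - (1 + x))%C with (- x)%C in H1 by ring. rewrite Cmod_opp, Cmod_1 in H1. lra. }
  rewrite Cmod_mult, <- Rpower_mult_distr; auto; [|now apply Cmod_gt_0].
  rewrite <- Rmult_minus_distr_l, Rabs_mult, (Rabs_pos_eq (Rpower _ _)) by (left; apply exp_pos).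
  replace (K * Rpower (Cmod a) rho * Cmod x ^ 3) with (Rpower (Cmod a) rho * (K * Cmod x ^ 3)) by ring.
  apply Rmult_le_compat_l; auto. left; apply exp_pos.
Qed.

(** * Circles avoiding the exceptional disks *)

(* The length of the part of the interval [(c - l, c + l)] to the left of [x]. *)
Definition clamp (c l x : R) : R := Rmax 0 (Rmin (x - (c - l)) (2 * l)).

Lemma clamp_incr (c l x y : R) : x <= y -> clamp c l x <= clamp c l y.
Proof.
  intros H. unfold clamp. apply Rle_max_compat_l, Rle_min_compat_r. lra.
Qed.

Lemma clamp_bounds (c l x : R) : 0 <= l -> 0 <= clamp c l x <= 2 * l.
Proof.
  intros H. unfold clamp. split; [apply Rmax_l|]. apply Rmax_lub; [lra|apply Rmin_r].
Qed.

Lemma clamp_inside (c l x : R) : Rabs (x - c) < l -> clamp c l x = x - (c - l).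
Proof.
  intros H. apply Rabs_def2 in H. unfold clamp. rewrite Rmin_left, Rmax_right; lra.
Qed.

Lemma sum_n_incr (u : nat -> R) (n k : nat) : (forall j, 0 <= u j) ->
  sum_n u n <= sum_n u (n + k).
Proof.
  intros H. induction k; [rewrite Nat.add_0_r; lra|].
  rewrite Nat.add_succ_r, sum_Sn. specialize (H (S (n + k))). unfold plus; simpl. lra.
Qed.

Lemma sum_n_ge_term (u : nat -> R) (n j : nat) : (forall j, 0 <= u j) -> (j <= n)%nat ->
  u j <= sum_n u n.
Proof.
  intros H Hj. replace n with (j + (n - j))%nat by lia.
  eapply Rle_trans; [|apply sum_n_incr; auto].
  destruct j; [rewrite sum_O; lra|]. rewrite sum_Sn. unfold plus; simpl.
  assert (0 <= sum_n u j); [|lra].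
  clear Hj. induction j; [rewrite sum_O; auto|]. rewrite sum_Sn. unfold plus; simpl.
  specialize (H (S j)). lra.
Qed.

Lemma sum_n_Rle (u v : nat -> R) (n : nat) : (forall j, u j <= v j) -> sum_n u n <= sum_n v n.
Proof.
  intros H. induction n; [rewrite !sum_O; auto|]. rewrite !sum_Sn. unfold plus; simpl.
  specialize (H (S n)). lra.
Qed.

Lemma sum_n_Rmult_l (k : R) (u : nat -> R) (n : nat) :
  sum_n (fun j => k * u j) n = k * sum_n u n.
Proof.
  induction n; [now rewrite !sum_O|]. rewrite !sum_Sn, IHn. unfold plus; simpl. ring.
Qed.

(* [x - A] is at most the total length of finitely many of the intervals inside
   [A, x]; the supremum of the [x] for which this holds cannot lie in any interval. *)
Lemma intervals_do_not_cover (c l : nat -> R) (sg A B : R) :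
  (forall j, 0 <= l j) -> (forall n, sum_n l n <= sg) -> A <= B -> 2 * sg < B - A ->
  exists t, A <= t <= B /\ forall j, l j <= Rabs (t - c j).
Proof.
  intros Hl Hs HAB Hlen. apply NNPP. intros Hno.
  assert (Hcov : forall t, A <= t <= B -> exists j, Rabs (t - c j) < l j).
  { intros t Ht. apply NNPP. intros H. apply Hno. exists t. split; auto.
    intros j. apply Rnot_lt_le. intros Hj. apply H. eauto. }
  (* Length of the first [n + 1] intervals inside [[A, x]], counted with multiplicity. *)
  set (m := fun n x => sum_n (fun j => clamp (c j) (l j) x - clamp (c j) (l j) A) n).
  set (P := fun x => A <= x <= B /\ exists n, x - A <= m n x).
  assert (Hpos : forall x, A <= x -> forall j, 0 <= clamp (c j) (l j) x - clamp (c j) (l j) A).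
  { intros x Hx j. pose proof (clamp_incr (c j) (l j) A x Hx). lra. }
  assert (Hm : forall n x, A <= x -> m n x <= 2 * sg).
  { intros n x Hx. apply Rle_trans with (sum_n (fun j => 2 * l j) n).
    - apply sum_n_Rle. intros j. pose proof (clamp_bounds (c j) (l j) x (Hl j)).
      pose proof (clamp_bounds (c j) (l j) A (Hl j)). lra.
    - rewrite sum_n_Rmult_l. specialize (Hs n). lra. }
  assert (Hstep : forall x y j, P x -> x <= y <= B -> Rabs (x - c j) < l j ->
    Rabs (y - c j) < l j -> P y).
  { intros x y j [Hx [n Hn]] Hy Hxj Hyj. split; [lra|]. exists (n + j)%nat.
    assert (y - x <= m (n + j)%nat y - m (n + j)%nat x).
    { unfold m.
      assert (E : forall k, sum_n (fun i => clamp (c i) (l i) y - clamp (c i) (l i) A) k -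
        sum_n (fun i => clamp (c i) (l i) x - clamp (c i) (l i) A) k =
        sum_n (fun i => clamp (c i) (l i) y - clamp (c i) (l i) x) k).
      { induction k; [rewrite !sum_O; ring|]. rewrite !sum_Sn. unfold plus; simpl. lra. }
      rewrite E.
      replace (y - x) with (clamp (c j) (l j) y - clamp (c j) (l j) x)
        by (rewrite !clamp_inside by auto; ring).
      apply (sum_n_ge_term (fun i => clamp (c i) (l i) y - clamp (c i) (l i) x)); [|lia].
      intros i. pose proof (clamp_incr (c i) (l i) x y ltac:(lra)). lra. }
    assert (m n x <= m (n + j)%nat x) by (apply sum_n_incr, Hpos; lra). lra. }
  assert (PA : P A).
  { split; [lra|]. exists 0%nat. unfold m. rewrite sum_O. lra. }
  destruct (completeness P) as [s [Hub Hlub]].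
  { exists B. intros x [Hx _]. lra. }
  { exists A. exact PA. }
  assert (Hs1 : A <= s) by (apply Hub; exact PA).
  assert (Hs2 : s <= B) by (apply Hlub; intros x [Hx _]; lra).
  destruct (Hcov s ltac:(lra)) as [j Hj].
  set (d := l j - Rabs (s - c j)). assert (Hd : 0 < d) by (unfold d; lra).
  assert (Hnear : forall y, Rabs (y - s) < d -> Rabs (y - c j) < l j).
  { intros y Hy. replace (y - c j) with ((y - s) + (s - c j)) by ring.
    eapply Rle_lt_trans; [apply Rabs_triang|]. unfold d in Hy. lra. }
  assert (exists x, P x /\ s - d < x) as [x [Px Hx]].
  { apply NNPP. intros H. assert (s <= s - d); [|lra]. apply Hlub. intros x Px.
    apply Rnot_lt_le. intros h. apply H. eauto. }
  assert (Hxs : x <= s) by (apply Hub; auto).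
  set (y := Rmin B (s + d / 2)).
  assert (Hy1 : s <= y) by (apply Rmin_glb; lra).
  assert (Hy2 : y <= s + d / 2) by apply Rmin_r.
  assert (Hy3 : y <= B) by apply Rmin_l.
  assert (Py : P y).
  { apply (Hstep x y j); auto; [lra| |]; apply Hnear; apply Rabs_def1; lra. }
  assert (Hys : y <= s) by (apply Hub; auto).
  (* A step beyond the supremum is impossible, so it was stopped by [B]; but [P B] contradicts the
     total length. *)
  assert (y = B) by (unfold y, Rmin in *; destruct Rle_dec; lra).
  destruct Py as [_ [n Hn]]. specialize (Hm n y ltac:(lra)). lra.
Qed.

Definition free (z : nat -> C) (r : nat -> R) (w : C) : Prop :=
  forall j, r j <= Cmod (w - z j).

(** A disk meets only those circles about [p] whose radius differs from [|z_j - p|] by less than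
    [r_j]: an interval of length [2 r_j]. *)
Lemma exists_free_radius (z : nat -> C) (r : nat -> R) (p : C) (sg A B : R) :
  (forall j, 0 <= r j) -> (forall n, sum_n r n <= sg) -> A <= B -> 2 * sg < B - A ->
  exists t, A <= t <= B /\
    forall w, Cmod (w - p) = t -> free z r w.
Proof.
  intros Hr Hs HAB Hlen.
  destruct (intervals_do_not_cover (fun j => Cmod (z j - p)) r sg A B) as [t [Ht H]]; auto.
  exists t. split; auto. intros w Hw j. eapply Rle_trans; [apply (H j)|].
  rewrite <- Hw. apply Rabs_le.
  pose proof (Cmod_sub_triangle w (z j) p). pose proof (Cmod_sub_triangle (z j) w p).
  rewrite (Cmod_sub_comm (z j) w) in H1. lra.
Qed.

(** * Zeros and exceptional disks *)

(** The first conjunct excludes zeros of [f], at which [ln] would return the default value 0. *)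
Definition log_close (rho M : R) (f : C -> C) (w : C) : Prop :=
  0 < Cmod (f w) /\ Rabs (Rpower (Cmod w) rho - ln (Cmod (f w))) <= M.

Lemma cder_quadratic (A B D b p : C) : exists l,
  cder (fun w => A + B * (w - b) + D * ((w - b) * (w - b)))%C p l.
Proof.
  assert (H := cder_id_sub b p).
  eexists. apply cder_plus.
  - apply (cder_ext (fun w => B * w + (A - B * b))%C _ _ B B);
      [intros; ring | auto | apply cder_affine].
  - apply (cder_mult (fun _ => D) (fun w => (w - b) * (w - b))%C).
    + apply (cder_ext (fun w => 0 * w + D)%C _ _ 0 0); [intros; ring|auto|apply cder_affine].
    + apply cder_mult; apply H.
Qed.

Lemma fst_RtoC_mult (x : R) (w : C) : fst (RtoC x * w)%C = x * fst w.
Proof. destruct w. simpl. ring. Qed.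

(* If [f] had no zero there, [e^g / f] would contradict the maximum principle, where
   [Re g] is the harmonic part of the second order Taylor polynomial of [|w|^rho]:
   the remaining part, [rho^2/4 |b|^rho |(w - b)/b|^2], exceeds the error [M]. *)
Lemma zero_exists (rho : R) : 0 < rho -> exists eta, 0 < eta <= / 8 /\
  forall (f : C -> C) (b : C) (t M : R),
    (forall p, exists l, cder f p l) -> 0 < t <= eta * Cmod b ->
    log_close rho M f b -> (forall w, Cmod (w - b) = t -> log_close rho M f w) ->
    2 * M < rho ^ 2 / 8 * Rpower (Cmod b) rho * (t / Cmod b) ^ 2 ->
    exists p, Cmod (p - b) <= t /\ f p = 0.
Proof.
  intros Hrho. destruct (Rpower_Cmod_expansion rho) as [K [HK HT]].
  (* For [m <= eta] the cubic error [K m^3] uses up at most half of the gain [rho^2/4 m^2]; the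
     other half is [X]. *)
  set (eta := Rmin (/ 8) (rho ^ 2 / (8 * (K + 1)))).
  assert (He1 : eta <= / 8) by apply Rmin_l.
  assert (He2 : K * eta <= rho ^ 2 / 8).
  { assert (eta <= rho ^ 2 / (8 * (K + 1))) by apply Rmin_r.
    apply Rle_trans with (K * (rho ^ 2 / (8 * (K + 1)))); [now apply Rmult_le_compat_l|].
    replace (K * (rho ^ 2 / (8 * (K + 1)))) with (rho ^ 2 / 8 * (K / (K + 1))) by (field; lra).
    rewrite <- (Rmult_1_r (rho ^ 2 / 8)) at 2. apply Rmult_le_compat_l; [nra|].
    apply Rle_div_l; lra. }
  assert (He0 : 0 < eta).
  { apply Rmin_pos; [lra|]. apply Rdiv_lt_0_compat; [nra|lra]. }
  exists eta. split; [lra|]. intros f b t M Hf Ht [Hb0 Hb1] Hcirc HM.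
  apply NNPP. intros Hno.
  assert (Hb : 0 < Cmod b) by nra.
  assert (Hbn : b <> 0) by now apply Cmod_gt_0.
  set (m := t / Cmod b) in *.
  assert (Hm : 0 < m) by (apply Rdiv_lt_0_compat; lra).
  assert (Hme : m <= eta) by (apply Rle_div_l; lra).
  set (P := Rpower (Cmod b) rho) in *. assert (HP : 0 < P) by apply exp_pos.
  set (X := rho ^ 2 / 8 * P * m ^ 2) in *.
  set (g := fun w : C => (P + P * rho / b * (w - b)
     + P * (rho * (rho - 2) / 4) / (b * b) * ((w - b) * (w - b)))%C).
  set (F := fun w => (cexp (g w) * / f w)%C).
  assert (Hnz : forall w, Cmod (w - b) <= t -> f w <> 0).
  { intros w Hw E. apply Hno. eauto. }
  assert (HF : holo_on (cdisk b t) F).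
  { intros w Hw. destruct (Hf w) as [l Hl].
    destruct (cder_quadratic P (P * rho / b)%C (P * (rho * (rho - 2) / 4) / (b * b))%C b w) as [m' Hm'].
    eexists. unfold F. apply cder_mult.
    - apply (cder_comp cexp g); [exact Hm' | apply cder_cexp].
    - apply (cder_comp Cinv f); [exact Hl | apply cder_inv, Hnz, Hw]. }
  assert (HFm : forall w, 0 < Cmod (f w) -> Cmod (F w) = exp (fst (g w) - ln (Cmod (f w)))).
  { intros w Hw. unfold F, Rminus. rewrite Cmod_mult, Cmod_cexp, Cmod_inv by now apply Cmod_gt_0.
    rewrite exp_plus, exp_Ropp, exp_ln by auto. reflexivity. }
  assert (Hmax : Cmod (F b) <= exp (M - X)).
  { apply (max_principle_center F b t); auto; [lra|].
    intros w Hw. destruct (Hcirc w Hw) as [h1 h2]. rewrite HFm by auto.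
    assert (Hg : fst (g w) - ln (Cmod (f w)) <= M - X); [|destruct Hg as [Hg | ->];
      [left; now apply exp_increasing | lra]].
    set (x := ((w - b) / b)%C).
    assert (Hx : Cmod x = m) by (unfold x; rewrite Cmod_div, Hw by auto; reflexivity).
    assert (Ew : w = (b * (1 + x))%C) by (unfold x; field; auto).
    specialize (HT b x Hbn ltac:(lra)). rewrite <- Ew, Hx in HT. fold P in HT.
    assert (Eg : fst (g w) = P * (1 + fst (rho * x + rho * (rho - 2) / 4 * (x * x))%C)).
    { rewrite Rmult_plus_distr_l, Rmult_1_r, <- fst_RtoC_mult.
      change (P + fst (P * (rho * x + rho * (rho - 2) / 4 * (x * x)))%C) with
        (fst (RtoC P + (P * (rho * x + rho * (rho - 2) / 4 * (x * x))))%C).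
      f_equal. unfold g, x. field. auto. }
    apply Rabs_le_between in HT, h2. rewrite Eg.
    set (Q := fst _) in *.
    assert (K * P * m ^ 3 <= rho ^ 2 / 8 * P * m ^ 2).
    { replace (K * P * m ^ 3) with (K * m * (P * m ^ 2)) by ring.
      rewrite (Rmult_assoc (rho ^ 2 / 8)). apply Rmult_le_compat_r; [apply Rmult_le_pos; nra|].
      apply Rle_trans with (K * eta); auto. now apply Rmult_le_compat_l. }
    unfold X. nra. }
  rewrite HFm in Hmax by auto. apply Rabs_le_between in Hb1.
  assert (Eb : fst (g b) = P).
  { unfold g. replace (b - b)%C with (RtoC 0) by ring.
    replace (P + P * rho / b * 0 + P * (rho * (rho - 2) / 4) / (b * b) * (0 * 0))%C with (RtoC P) by ring.
    reflexivity. }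
  rewrite Eb in Hmax. fold P in Hb1.
  (* At the centre there is no quadratic gain, so [|F b| >= exp (- M)], and [2 * M < X]. *)
  assert (exp (M - X) < exp (P - ln (Cmod (f b)))) by (apply exp_increasing; lra). lra.
Qed.

(* After division by [e^g], with [g] the linear Taylor polynomial at the zero [p],
   [f] varies by a bounded factor; a Lipschitz bound then keeps [f] small near [p]. *)
Lemma zero_forces_radii (rho : R) : 0 < rho -> exists C1, 0 <= C1 /\
  forall (f : C -> C) (p : C) (q M sg : R) (z : nat -> C) (r : nat -> R),
    (forall w, exists l, cder f w l) -> f p = 0 -> 0 < q -> 16 * q <= Cmod p ->
    0 < sg -> 6 * sg <= q -> (forall j, 0 <= r j) -> (forall n, sum_n r n <= sg) ->
    (forall w, Cmod (w - p) <= 2 * q -> free z r w -> log_close rho M f w) ->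
    q <= 12 * sg * exp (2 * M + 2 * (C1 * Rpower (Cmod p) rho * (2 * q / Cmod p) ^ 2)).
Proof.
  intros Hrho. destruct (Rpower_Cmod_expansion rho) as [K [HK HT]].
  set (C0 := Rabs (rho * (rho - 2) / 4)). assert (HC0 : 0 <= C0) by apply Rabs_pos.
  exists (C0 + rho ^ 2 / 4 + K). split; [nra|].
  (* The three summands bound the quadratic harmonic term, the term in [|x|^2], and the cubic error;
     here all of them count as error, as [g] is only linear. *)
  set (C1 := C0 + rho ^ 2 / 4 + K).
  intros f p q M sg z r Hf Hfp Hq Hqp Hsg Hsq Hr Hs Hlc.
  assert (Hp : 0 < Cmod p) by lra.
  assert (Hpn : p <> 0) by now apply Cmod_gt_0.
  set (P := Rpower (Cmod p) rho) in *. assert (HP : 0 < P) by apply exp_pos.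
  set (Q := C1 * P * (2 * q / Cmod p) ^ 2).
  (* The zero quadratic term only gives [g] the shape of [cder_quadratic]. *)
  set (g := fun w : C => (P + P * rho / p * (w - p) + 0 * ((w - p) * (w - p)))%C).
  assert (Hg : forall w, Cmod (w - p) <= 2 * q -> Rabs (Rpower (Cmod w) rho - fst (g w)) <= Q).
  { intros w Hw.
    set (x := ((w - p) / p)%C). set (m := Cmod x).
    assert (Hx : m <= 2 * q / Cmod p).
    { unfold m, x; rewrite Cmod_div by auto. apply Rmult_le_compat_r; auto.
      left; now apply Rinv_0_lt_compat. }
    assert (Hm0 : 0 <= m) by apply Cmod_ge_0.
    assert (Hm8 : m <= / 8).
    { eapply Rle_trans; [exact Hx|]. apply Rle_div_l; lra. }
    assert (Ew : w = (p * (1 + x))%C) by (unfold x; field; auto).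
    specialize (HT p x Hpn Hm8). rewrite <- Ew in HT. fold P m in HT.
    assert (Eg : fst (g w) = P * (1 + rho * fst x)).
    { rewrite <- fst_RtoC_mult, Rmult_plus_distr_l, Rmult_1_r, <- fst_RtoC_mult.
      change (P + fst (P * (rho * x))%C) with (fst (RtoC P + P * (rho * x))%C).
      f_equal. unfold g, x. field. auto. }
    assert (Ex : fst (rho * x + rho * (rho - 2) / 4 * (x * x))%C =
                 rho * fst x + rho * (rho - 2) / 4 * fst (x * x)%C).
    { rewrite <- !fst_RtoC_mult, RtoC_div, RtoC_mult, RtoC_minus by lra. reflexivity. }
    rewrite Ex in HT. rewrite Eg.
    assert (Hxx : Rabs (rho * (rho - 2) / 4 * fst (x * x)%C) <= C0 * m ^ 2).
    { rewrite Rabs_mult. apply Rmult_le_compat_l; [apply Rabs_pos|].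
      eapply Rle_trans; [apply abs_fst_le_Cmod|]. rewrite Cmod_mult. fold m. simpl. lra. }
    set (y := rho * (rho - 2) / 4 * fst (x * x)%C) in *.
    assert (HQ : P * (C1 * m ^ 2) <= Q).
    { unfold Q. replace (C1 * P * (2 * q / Cmod p) ^ 2) with (P * (C1 * (2 * q / Cmod p) ^ 2)) by ring.
      apply Rmult_le_compat_l; [lra|]. apply Rmult_le_compat_l; [unfold C1; nra|].
      apply pow_incr; auto. }
    eapply Rle_trans; [|exact HQ].
    apply Rabs_le_between in HT, Hxx.
    assert (P * y <= P * (C0 * m ^ 2)) by (apply Rmult_le_compat_l; lra).
    assert (P * - (C0 * m ^ 2) <= P * y) by (apply Rmult_le_compat_l; lra).
    assert (K * P * m ^ 3 <= K * P * m ^ 2).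
    { apply Rmult_le_compat_l; [nra|]. simpl. nra. }
    assert (0 <= P * m ^ 2) by nra.
    unfold C1. apply Rabs_le. split; nra. }
  set (h := fun w => (f w * cexp (- g w))%C).
  assert (Hh : forall w, exists l, cder h w l).
  { intros w. destruct (Hf w) as [l Hl].
    destruct (cder_quadratic P (P * rho / p)%C 0 p w) as [m' Hm'].
    eexists. unfold h. apply cder_mult; [exact Hl|].
    apply (cder_comp cexp (fun w => - g w)%C); [|apply cder_cexp].
    apply (cder_ext (fun w => (- (1)) * g w)%C _ _ (0 * g w + (- (1)) * m')%C _).
    - intros; ring.
    - reflexivity.
    - apply (cder_mult (fun _ => - (1))%C g); [|exact Hm'].
      apply (cder_ext (fun w => 0 * w + - (1))%C _ _ 0 0); [intros; ring|auto|apply cder_affine]. }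
  assert (Hhm : forall w, 0 < Cmod (f w) -> Cmod (h w) = exp (ln (Cmod (f w)) - fst (g w))).
  { intros w Hw. unfold h, Rminus. rewrite Cmod_mult, Cmod_cexp.
    rewrite exp_plus, exp_ln by auto. reflexivity. }
  assert (Hbd : forall w, Cmod (w - p) <= 2 * q -> free z r w ->
    exp (- (M + Q)) <= Cmod (h w) <= exp (M + Q)).
  { intros w Hw Hfw. destruct (Hlc w Hw Hfw) as [h1 h2]. rewrite Hhm by auto.
    specialize (Hg w Hw). apply Rabs_le_between in Hg, h2. split.
    - destruct (Req_dec (- (M + Q)) (ln (Cmod (f w)) - fst (g w))) as [->|]; [lra|].
      left. apply exp_increasing. lra.
    - destruct (Req_dec (M + Q) (ln (Cmod (f w)) - fst (g w))) as [<-|]; [lra|].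
      left. apply exp_increasing. lra. }
  assert (Hder : forall w, Cmod (w - p) <= q ->
    exists l, cder h w l /\ Cmod l <= 4 * exp (M + Q) / q).
  { intros w Hw.
    (* A window of length [q / 2] exceeds [2 * sg], and these circles stay within [2 * q] of [p]. *)
    destruct (exists_free_radius z r w sg (q / 2) q) as [t [Ht Hfree]]; auto; try lra.
    destruct (Hh w) as [l Hl]. exists l. split; auto.
    apply Rle_trans with (2 * exp (M + Q) / t).
    - apply (cauchy_estimate h w l t); auto; [lra|intros v _; apply Hh|].
      intros v Hv. apply Hbd; [|exact (Hfree v Hv)].
      pose proof (Cmod_sub_triangle v w p). lra.
    - pose proof (exp_pos (M + Q)). apply Rle_div_l; [lra|].
      replace (4 * exp (M + Q) / q * t) with (2 * exp (M + Q) * (2 * t / q)) by (field; lra).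
      rewrite <- (Rmult_1_r (2 * exp (M + Q))) at 1. apply Rmult_le_compat_l; [lra|].
      apply Rle_div_r; lra. }
  (* At a free point this close to the zero, the lower bound for [h] meets the Lipschitz bound; the
     final constant 12 is [4 * 3]. *)
  destruct (exists_free_radius z r p sg 0 (3 * sg)) as [t [Ht Hfree]]; auto; try lra.
  assert (Et : Cmod (p + t - p)%C = t).
  { replace (p + t - p)%C with (RtoC t) by ring. rewrite Cmod_R. apply Rabs_pos_eq; lra. }
  destruct (Hbd (p + t)%C) as [Hlow _]; [lra|exact (Hfree _ Et)|].
  assert (Hlip : Cmod (h (p + t)%C - h p)%C <= 4 * exp (M + Q) / q * t).
  { apply mean_value_real_line; [lra|]. intros y Hy. apply Hder.
    replace (p + y - p)%C with (RtoC y) by ring. rewrite Cmod_R, Rabs_pos_eq; lra. }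
  replace (h (p + t)%C - h p)%C with (h (p + t)%C) in Hlip by (unfold h; rewrite Hfp; ring).
  pose proof (exp_pos (M + Q)) as HE.
  rewrite exp_Ropp in Hlow.
  assert (H1 : / exp (M + Q) <= 4 * exp (M + Q) / q * (3 * sg)).
  { eapply Rle_trans; [exact Hlow|]. eapply Rle_trans; [exact Hlip|].
    apply Rmult_le_compat_l; [|lra]. apply Rdiv_le_0_compat; lra. }
  fold Q.
  replace (2 * M + 2 * Q) with ((M + Q) + (M + Q)) by ring. rewrite exp_plus.
  apply (Rmult_le_compat_l (q * exp (M + Q))) in H1; [|nra].
  replace (q * exp (M + Q) * / exp (M + Q)) with q in H1 by (field; lra).
  replace (q * exp (M + Q) * (4 * exp (M + Q) / q * (3 * sg))) with
    (12 * sg * (exp (M + Q) * exp (M + Q))) in H1 by (field; lra).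
  exact H1.
Qed.

(** * Counting over the annulus *)

Lemma Rpower_eventually_gt (c A : R) : 0 < c -> exists T0, 1 <= T0 /\
  forall T, T0 < T -> A < Rpower T c.
Proof.
  intros Hc. set (A' := Rmax A 1).
  exists (Rmax 1 (Rpower A' (/ c))). split; [apply Rmax_l|].
  intros T HT.
  assert (H1 : 1 < T) by (eapply Rle_lt_trans; [apply Rmax_l|exact HT]).
  assert (H2 : Rpower A' (/ c) < T) by (eapply Rle_lt_trans; [apply Rmax_r|exact HT]).
  assert (HA : 1 <= A') by apply Rmax_r.
  apply Rle_lt_trans with A'; [apply Rmax_l|].
  rewrite <- (Rpower_1 A') at 1 by lra. rewrite <- (Rinv_l c) by lra.
  rewrite <- Rpower_mult. apply Rlt_Rpower_l; auto. split; [apply exp_pos|auto].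
Qed.

Lemma ln_le_Rpower (T c : R) : 0 < T -> 0 < c -> ln T <= Rpower T c / c.
Proof.
  intros HT Hc. apply Rle_div_r; auto. unfold Rpower.
  pose proof (exp_ineq1_le (c * ln T)). lra.
Qed.

(** The threshold [T0] is chosen before [a], [z] and [r]: one threshold must serve all centres of a
    grid, and each centre comes with its own truncated radii. *)
Lemma local_radii_sum (rho C2 eps : R) (f : C -> C) :
  0 < rho -> 0 < C2 -> 0 < eps -> eps < rho / 2 -> (forall p, exists l, cder f p l) ->
  exists T0, forall T, T0 < T -> forall (a : C) (z : nat -> C) (r : nat -> R),
    14 / 10 * T <= Cmod a <= 16 / 10 * T -> (forall j, 0 <= r j) ->
    (forall w, Cmod (w - a) <= 4 * Rpower T (1 - rho / 2 + eps) -> free z r w ->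
       log_close rho (C2 * ln (2 * T)) f w) ->
    exists n, Rpower T (1 - rho / 2 - 2 * C2 - eps / 2) < sum_n r n.
Proof.
  intros Hrho HC2 Heps Heps2 Hf.
  destruct (zero_exists rho Hrho) as [eta [Heta HZ]].
  destruct (zero_forces_radii rho Hrho) as [C1 [HC1 HR]].
  set (b := 1 - rho / 2 + eps).
  (* [T^eps > A2] makes the quadratic gain [rho^2/128 * T^(2*eps)] exceed [2 * M], where
     [ln T <= T^eps / eps]. [A3] gathers the constants of [zero_forces_radii]: 12, the factor 2 in
     [ln (2 * T)], and the bounded Taylor error. *)
  set (A2 := 128 * (2 * C2 * (1 + / eps)) / rho ^ 2).
  set (A3 := 12 * Rpower 2 (2 * C2) * exp (8 * C1 * Rpower 2 rho)).
  destruct (Rpower_eventually_gt (1 - b) (100 + 2 / eta)) as [t1 [Ht1 HT1]]; [unfold b; lra|].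
  destruct (Rpower_eventually_gt eps (1 + A2) Heps) as [t2 [Ht2 HT2]].
  destruct (Rpower_eventually_gt (eps / 2) (A3 + 100)) as [t3 [Ht3 HT3]]; [lra|].
  exists (Rmax t1 (Rmax t2 t3)). intros T HT a z r Ha Hr Hlc.
  assert (HTa : t1 < T) by (eapply Rle_lt_trans; [apply Rmax_l|exact HT]).
  assert (HTb : t2 < T)
    by (eapply Rle_lt_trans; [|exact HT]; eapply Rle_trans; [apply Rmax_l|apply Rmax_r]).
  assert (HTc : t3 < T)
    by (eapply Rle_lt_trans; [|exact HT]; eapply Rle_trans; [apply Rmax_r|apply Rmax_r]).
  specialize (HT1 T HTa). specialize (HT2 T HTb). specialize (HT3 T HTc).
  assert (H0 : 1 < T) by lra.
  apply NNPP. intros Hno.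
  set (s := Rpower T b) in *.
  set (q := Rpower T (1 - rho / 2)).
  set (sg := Rpower T (1 - rho / 2 - 2 * C2 - eps / 2)) in *.
  set (M := C2 * ln (2 * T)) in *.
  assert (Hs : 0 < s) by apply exp_pos. assert (Hq : 0 < q) by apply exp_pos.
  assert (Hsg : 0 < sg) by apply exp_pos.
  assert (Hsum : forall n, sum_n r n <= sg).
  { intros n. apply Rnot_lt_le. intros h. apply Hno. eauto. }
  assert (ET : T = s * Rpower T (1 - b)).
  { unfold s. rewrite <- Rpower_plus. replace (b + (1 - b)) with 1 by ring. rewrite Rpower_1; lra. }
  assert (HsT : 100 * s <= T).
  { rewrite ET. assert (0 < 2 / eta) by (apply Rdiv_lt_0_compat; lra). nra. }
  assert (HsE : s <= eta * T).
  { assert (2 / eta * eta = 2) by (field; lra).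
    apply Rle_trans with (s * (eta * (2 / eta))).
    - nra.
    - rewrite ET. assert (eta * (2 / eta) <= eta * Rpower T (1 - b)) by (apply Rmult_le_compat_l; lra). nra. }
  assert (Hqs : q <= s) by (apply Rle_Rpower; [lra|unfold b; lra]).
  set (D := Rpower T (2 * C2)).
  assert (HD : 1 <= D).
  { rewrite <- (Rpower_O T) by lra. apply Rle_Rpower; lra. }
  assert (Eq : q = sg * D * Rpower T (eps / 2)).
  { unfold q, sg, D. rewrite <- !Rpower_plus. f_equal. field. }
  assert (HA3 : 0 < A3) by (unfold A3; pose proof (exp_pos (8 * C1 * Rpower 2 rho));
    assert (0 < Rpower 2 (2 * C2)) by apply exp_pos; nra).
  assert (HsgD : sg <= sg * D) by nra.
  assert (Hsq : 100 * sg <= q) by (rewrite Eq; nra).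
  (* The point [a] may itself be exceptional, so the search for a zero is centred at a nearby free
     point [c]. *)
  destruct (exists_free_radius z r a sg 0 s) as [t0 [Ht0 Hfree0]]; auto; try lra.
  set (c := (a + t0)%C).
  assert (Hca : Cmod (c - a) = t0).
  { unfold c. replace (a + t0 - a)%C with (RtoC t0) by ring. rewrite Cmod_R. apply Rabs_pos_eq; lra. }
  assert (Hmod : forall w, Cmod (w - a) <= 4 * s -> T <= Cmod w <= 2 * T).
  { intros w Hw. pose proof (Cmod_triangle_sub w a). pose proof (Cmod_triangle_sub a w).
    rewrite (Cmod_sub_comm a w) in H1. lra. }
  destruct (exists_free_radius z r c sg (s / 2) s) as [t [Ht Hfree]]; auto; try lra.
  assert (Hc := Hmod c ltac:(lra)).
  destruct (HZ f c t M) as [p [Hp Hfp]]; auto.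
  { split; [lra|]. apply Rle_trans with s; [lra|]. eapply Rle_trans; [exact HsE|].
    apply Rmult_le_compat_l; lra. }
  { apply Hlc; [lra|exact (Hfree0 c Hca)]. }
  { intros w Hw. apply Hlc; [|exact (Hfree w Hw)].
    pose proof (Cmod_sub_triangle w c a). lra. }
  { assert (HP : Rpower T rho <= Rpower (Cmod c) rho) by (apply Rle_Rpower_l; lra).
    assert (Hr2 : (s / (4 * T)) ^ 2 <= (t / Cmod c) ^ 2).
    { apply pow_incr. split; [apply Rdiv_le_0_compat; lra|].
      replace (s / (4 * T)) with (s / 2 * / (2 * T)) by (field; lra).
      assert (0 < / (2 * T)) by (apply Rinv_0_lt_compat; lra).
      apply Rmult_le_compat; try lra. apply Rinv_le_contravar; lra. }
    assert (Epow : Rpower T rho * (s * s) = Rpower T eps * Rpower T eps * (T * T)).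
    { transitivity (Rpower T eps * Rpower T eps * (Rpower T 1 * Rpower T 1)); [|rewrite Rpower_1; lra].
      unfold s. rewrite <- !Rpower_plus. f_equal. unfold b. field. }
    apply Rlt_le_trans with (rho ^ 2 / 8 * Rpower T rho * (s / (4 * T)) ^ 2).
    - replace (rho ^ 2 / 8 * Rpower T rho * (s / (4 * T)) ^ 2) with
        (rho ^ 2 / 128 * (Rpower T rho * (s * s)) / (T * T)) by (field; lra).
      rewrite Epow.
      replace (rho ^ 2 / 128 * (Rpower T eps * Rpower T eps * (T * T)) / (T * T)) with
        (rho ^ 2 / 128 * Rpower T eps * Rpower T eps) by (field; lra).
      set (X := Rpower T eps) in *.
      assert (HA2 : 0 < A2).
      { unfold A2. apply Rdiv_lt_0_compat; [|nra]. assert (0 < / eps) by now apply Rinv_0_lt_compat. nra. }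
      assert (HM : 2 * M <= 2 * C2 * (1 + / eps) * X).
      { unfold M. rewrite ln_mult by lra.
        assert (ln 2 <= 1) by (pose proof ln_lt_2; pose proof (exp_ineq1_le (ln 2)); rewrite exp_ln in *; lra).
        pose proof (ln_le_Rpower T eps ltac:(lra) Heps) as HL. fold X in HL. unfold Rdiv in HL.
        assert (ln 2 + ln T <= (1 + / eps) * X) by lra. nra. }
      assert (EA : 2 * C2 * (1 + / eps) = rho ^ 2 / 128 * A2) by (unfold A2; field; lra).
      rewrite EA in HM. eapply Rle_lt_trans; [exact HM|].
      apply Rmult_lt_compat_r; [lra|]. apply Rmult_lt_compat_l; [nra|lra].
    - apply Rmult_le_compat; auto.
      + apply Rmult_le_pos; [nra|left; apply exp_pos].
      + apply pow2_ge_0.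
      + apply Rmult_le_compat_l; [nra|auto]. }
  assert (Hpa : Cmod (p - a) <= 2 * s) by (pose proof (Cmod_sub_triangle p c a); lra).
  assert (Hpm := Hmod p ltac:(lra)).
  specialize (HR f p q M sg z r Hf Hfp Hq ltac:(lra) Hsg ltac:(lra) Hr Hsum).
  assert (HR' := HR (fun w Hw Hfr => Hlc w
    ltac:(pose proof (Cmod_sub_triangle w p a); lra) Hfr)). clear HR.
  assert (HQ : C1 * Rpower (Cmod p) rho * (2 * q / Cmod p) ^ 2 <= 4 * C1 * Rpower 2 rho).
  { assert (HP : Rpower (Cmod p) rho <= Rpower 2 rho * Rpower T rho).
    { rewrite Rpower_mult_distr by lra. apply Rle_Rpower_l; lra. }
    assert (Hr2 : (2 * q / Cmod p) ^ 2 <= (2 * q / T) ^ 2).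
    { apply pow_incr. split; [apply Rdiv_le_0_compat; lra|].
      apply Rmult_le_compat_l; [lra|]. apply Rinv_le_contravar; lra. }
    assert (Epow : Rpower T rho * (q * q) = T * T).
    { transitivity (Rpower T 1 * Rpower T 1); [|rewrite Rpower_1; lra].
      unfold q. rewrite <- !Rpower_plus. f_equal. field. }
    apply Rle_trans with (C1 * (Rpower 2 rho * Rpower T rho) * (2 * q / T) ^ 2).
    - apply Rmult_le_compat; auto.
      + apply Rmult_le_pos; [auto|left; apply exp_pos].
      + apply pow2_ge_0.
      + apply Rmult_le_compat_l; auto.
    - replace (C1 * (Rpower 2 rho * Rpower T rho) * (2 * q / T) ^ 2) with
        (4 * C1 * Rpower 2 rho * (Rpower T rho * (q * q)) / (T * T)) by (field; lra).
      rewrite Epow. apply Req_le. field. lra. }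
  assert (HE : exp (2 * M + 2 * (C1 * Rpower (Cmod p) rho * (2 * q / Cmod p) ^ 2)) <=
    Rpower 2 (2 * C2) * D * exp (8 * C1 * Rpower 2 rho)).
  { unfold D. rewrite Rpower_mult_distr by lra. unfold Rpower at 2. rewrite <- exp_plus.
    replace (2 * C2 * ln (2 * T)) with (2 * M) by (unfold M; ring).
    destruct (Req_dec (2 * (C1 * Rpower (Cmod p) rho * (2 * q / Cmod p) ^ 2)) (8 * C1 * Rpower 2 rho)) as [->|]; [lra|].
    left. apply exp_increasing. lra. }
  assert (HF : q <= sg * D * A3).
  { eapply Rle_trans; [exact HR'|]. unfold A3.
    replace (sg * D * (12 * Rpower 2 (2 * C2) * exp (8 * C1 * Rpower 2 rho))) with
      (12 * sg * (Rpower 2 (2 * C2) * D * exp (8 * C1 * Rpower 2 rho))) by ring.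
    apply Rmult_le_compat_l; [lra|exact HE]. }
  (* Cancelling [sg * D] leaves [T^(eps/2) <= A3], against the choice of [t3]. *)
  rewrite Eq in HF. apply Rmult_le_reg_l in HF; [lra|nra].
Qed.

Lemma sum_n_zero (u : nat -> R) (n : nat) : (forall i, (i <= n)%nat -> u i = 0) -> sum_n u n = 0.
Proof.
  induction n; intros H; [rewrite sum_O; auto|].
  rewrite sum_Sn, IHn by (intros; apply H; lia). rewrite (H (S n)) by lia.
  unfold plus; simpl. ring.
Qed.

Lemma sum_n_disjoint_le (u : nat -> R) (v : R) (n : nat) : 0 <= v ->
  (forall i, (i <= n)%nat -> u i <= v) ->
  (forall i k, (i <= n)%nat -> (k <= n)%nat -> i <> k -> u i = 0 \/ u k = 0) ->
  sum_n u n <= v.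
Proof.
  intros Hv. induction n; intros Hu Hd; [rewrite sum_O; auto|].
  rewrite sum_Sn. unfold plus; simpl.
  destruct (Req_dec (u (S n)) 0) as [E|E].
  - rewrite E, Rplus_0_r. apply IHn; intros; [apply Hu | apply Hd]; lia.
  - rewrite sum_n_zero.
    + rewrite Rplus_0_l. apply Hu. lia.
    + intros i Hi. destruct (Hd i (S n)) as [h|h]; auto; try lia. contradiction.
Qed.

Lemma uniform_index (P : nat -> nat -> Prop) (k : nat) :
  (forall i n m, (n <= m)%nat -> P i n -> P i m) ->
  (forall i, (i <= k)%nat -> exists n, P i n) -> exists n, forall i, (i <= k)%nat -> P i n.
Proof.
  intros Hmon. induction k; intros H.
  - destruct (H 0%nat (le_n _)) as [n Hn]. exists n. intros i Hi. now replace i with 0%nat by lia.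
  - destruct IHk as [n Hn]; [intros; apply H; lia|].
    destruct (H (S k) (le_n _)) as [m Hm].
    exists (Nat.max n m). intros i Hi. destruct (Nat.eq_dec i (S k)) as [->|].
    + apply Hmon with m; auto; lia.
    + apply Hmon with n; [lia|]. apply Hn. lia.
Qed.

(** Distant disks get radius 0 instead of being removed: the index set is unchanged, and radius 0
    imposes nothing in [free]. *)
Definition near_radius (z : nat -> C) (r : nat -> R) (a : C) (d : R) (j : nat) : R :=
  if Rle_dec (Cmod (z j - a)) d then r j else 0.

(** Double counting: after exchanging the sums, separation lets each [z j] be near at most one
    centre, so [r j] is counted at most once. *)
Lemma separated_radii_sum (z : nat -> C) (r v : nat -> R) (a : nat -> C) (d sg : R) (k : nat) :
  (forall j, 0 <= r j) -> (forall j, 0 <= v j) ->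
  (forall i j, (i <= k)%nat -> Cmod (z j - a i) <= d -> r j <= v j) ->
  (forall i i', (i <= k)%nat -> (i' <= k)%nat -> i <> i' -> 2 * d < Cmod (a i - a i')) ->
  (forall i, (i <= k)%nat -> exists n, sg <= sum_n (near_radius z r (a i) d) n) ->
  exists n, INR (S k) * sg <= sum_n v n.
Proof.
  intros Hr Hv Hrv Hsep Hex.
  assert (Hn0 : forall i j, 0 <= near_radius z r (a i) d j).
  { intros i j. unfold near_radius. destruct Rle_dec; auto; lra. }
  destruct (uniform_index (fun i n => sg <= sum_n (near_radius z r (a i) d) n) k) as [n Hn]; auto.
  { intros i n m Hnm H. replace m with (n + (m - n))%nat by lia.
    eapply Rle_trans; [exact H|]. now apply sum_n_incr. }
  exists n.
  apply Rle_trans with (sum_n (fun i => sum_n (near_radius z r (a i) d) n) k).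
  - rewrite Rmult_comm. clear Hrv Hsep Hex. induction k.
    + rewrite sum_O. simpl. rewrite Rmult_1_r. auto.
    + rewrite sum_Sn, S_INR. unfold plus; simpl.
      specialize (IHk (fun i Hi => Hn i ltac:(lia))). specialize (Hn (S k) (le_n _)).
      change (match k with O => 1 | S _ => INR k + 1 end) with (INR (S k)). lra.
  - rewrite sum_n_switch. apply sum_n_Rle. intros j.
    apply sum_n_disjoint_le; auto.
    + intros i Hi. unfold near_radius. destruct Rle_dec; eauto.
    + intros i i' Hi Hi' Hne. unfold near_radius.
      destruct Rle_dec as [h1|]; [|now left]. destruct Rle_dec as [h2|]; [|now right].
      exfalso. specialize (Hsep i i' Hi Hi' Hne).
      pose proof (Cmod_sub_triangle (a i) (z j) (a i')).
      rewrite (Cmod_sub_comm (a i) (z j)) in H. lra.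
Qed.

Lemma INR_sub_ge_1 (m n : nat) : m <> n -> 1 <= Rabs (INR m - INR n).
Proof.
  intros H. destruct (Nat.lt_total m n) as [h|[h|h]]; [|contradiction|].
  - apply (le_INR (S m)) in h. rewrite S_INR in h. rewrite Rabs_minus_sym.
    eapply Rle_trans; [|apply Rle_abs]. lra.
  - apply (le_INR (S n)) in h. rewrite S_INR in h.
    eapply Rle_trans; [|apply Rle_abs]. lra.
Qed.

Lemma separated_grid (x0 d L : R) : 0 < d -> 0 < x0 -> 2 * d <= L -> exists (a : nat -> C) (k : nat),
  (L / (2 * d)) ^ 2 <= INR (S k) /\
  (forall i, (i <= k)%nat -> x0 <= Cmod (a i) <= x0 + 2 * L) /\
  (forall i i', (i <= k)%nat -> (i' <= k)%nat -> i <> i' -> d <= Cmod (a i - a i')).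
Proof.
  intros Hd Hx0 HL.
  assert (H2 : 2 <= L / d) by (apply Rle_div_r; lra).
  destruct (nfloor_ex (L / d)) as [N [HN1 HN2]]; [lra|].
  assert (HN : (1 <= N)%nat) by (apply INR_le; simpl; lra).
  (* A square grid of [N * N] points to the right of [x0], indexed from 0 to [N * N - 1]. As
     [L / d >= 2], rounding down to [N] loses at most a factor 2. *)
  exists (fun i => (x0 + d * INR (i / N), d * INR (i mod N))), (N * N - 1)%nat.
  assert (HdN : d * INR N <= L).
  { apply (Rmult_le_compat_l d) in HN1; [|lra]. replace (d * (L / d)) with L in HN1 by (field; lra). auto. }
  split; [|split].
  - replace (S (N * N - 1)) with (N * N)%nat by nia. rewrite mult_INR.
    replace (L / (2 * d)) with (L / d / 2) by (field; lra). nra.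
  - intros i Hi.
    assert (Hq : (i / N <= N)%nat) by (apply Nat.Div0.div_le_upper_bound; nia).
    assert (Hm : (i mod N <= N)%nat) by (pose proof (Nat.mod_upper_bound i N); lia).
    apply le_INR in Hq, Hm. pose proof (pos_INR (i / N)). pose proof (pos_INR (i mod N)).
    split.
    + eapply Rle_trans; [|apply abs_fst_le_Cmod]. simpl.
      eapply Rle_trans; [|apply Rle_abs]. nra.
    + eapply Rle_trans; [apply Cmod_le_abs|]. simpl. rewrite !Rabs_pos_eq by nra. nra.
  - intros i i' Hi Hi' Hne.
    assert (Hcase : (i / N <> i' / N \/ i mod N <> i' mod N)%nat).
    { destruct (Nat.eq_dec (i / N) (i' / N)) as [E|]; [right|now left]. intros E'.
      apply Hne. rewrite (Nat.div_mod_eq i N), (Nat.div_mod_eq i' N). now rewrite E, E'. }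
    destruct Hcase as [Hc|Hc]; apply INR_sub_ge_1 in Hc.
    + eapply Rle_trans; [|apply abs_fst_le_Cmod].
      replace (fst _) with (d * (INR (i / N) - INR (i' / N))) by (simpl; ring).
      rewrite Rabs_mult, (Rabs_pos_eq d) by lra. nra.
    + eapply Rle_trans; [|apply abs_snd_le_Cmod].
      replace (snd _) with (d * (INR (i mod N) - INR (i' mod N))) by (simpl; ring).
      rewrite Rabs_mult, (Rabs_pos_eq d) by lra. nra.
Qed.

(** * From the extended-real hypotheses to the local estimates *)

Lemma rpow_pos (t a : R) : 0 < t -> rpow t a = Rpower t a.
Proof. intros H. unfold rpow. destruct Rlt_dec; [auto|contradiction]. Qed.

Lemma xlog_pos (t : R) : 0 < t -> xlog t = Finite (ln t).
Proof. intros H. unfold xlog. destruct Rlt_dec; [auto|contradiction]. Qed.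

(** At a zero of [f] the left side would be [p_infty] and the right side finite, so the hypothesis
    yields positivity as well. *)
Lemma log_close_of_xlog (rho C2 : R) (f : C -> C) (w : C) : 0 < Cmod w ->
  Rbar_le (Rbar_abs (Rbar_minus (Finite (rpow (Cmod w) rho)) (xlog (Cmod (f w)))))
          (Rbar_mult (Finite C2) (xlog (Cmod w))) ->
  log_close rho (C2 * ln (Cmod w)) f w.
Proof.
  intros Hw. rewrite rpow_pos, (xlog_pos (Cmod w)) by auto. unfold log_close.
  unfold xlog. destruct Rlt_dec as [h|h]; simpl; [auto|tauto].
Qed.

(** The right side is [m_infty], which no absolute value reaches. *)
Lemma xlog_bound_fails_at_0 (rho C2 : R) (f : C -> C) : 0 < C2 ->
  ~ Rbar_le (Rbar_abs (Rbar_minus (Finite (rpow (Cmod 0) rho)) (xlog (Cmod (f 0)))))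
            (Rbar_mult (Finite C2) (xlog (Cmod 0))).
Proof.
  intros HC2. rewrite Cmod_0. unfold xlog at 2. destruct Rlt_dec as [h|h]; [lra|].
  replace (Rbar_mult (Finite C2) m_infty) with m_infty.
  - destruct (Rbar_minus _ _); simpl; auto.
  - symmetry. apply is_Rbar_mult_unique, is_Rbar_mult_sym. now apply is_Rbar_mult_m_infty_pos.
Qed.

(* For [eps = rho / 2] the hypotheses are contradictory: no disk with
   [r j <= Cmod (z j)] contains [0], while [0] must be in [E]. *)
Lemma eps_lt_half_rho (rho C2 eps : R) (f : C -> C) (E : C -> Prop)
    (z : nat -> C) (r : nat -> R) :
  0 < C2 -> eps <= rho / 2 ->
  (forall w : C, ~ E w ->
     Rbar_le
       (Rbar_abs (Rbar_minus (Finite (rpow (Cmod w) rho)) (xlog (Cmod (f w)))))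
       (Rbar_mult (Finite C2) (xlog (Cmod w)))) ->
  (forall w : C, E w -> exists j : nat, disk (z j) (r j) w) ->
  (forall j : nat, r j <= rpow (Cmod (z j)) (1 - rho / 2 + eps)) ->
  eps < rho / 2.
Proof.
  intros HC2 [H|Heq] Happ Hcov Hr; auto. exfalso.
  destruct (classic (E 0)) as [H0|H0].
  - destruct (Hcov 0 H0) as [j Hj]. unfold disk in Hj.
    replace (0 - z j)%C with (- z j)%C in Hj by ring. rewrite Cmod_opp in Hj.
    specialize (Hr j). replace (1 - rho / 2 + eps) with 1 in Hr by lra.
    destruct (Cmod_ge_0 (z j)) as [h|h].
    + rewrite rpow_pos, Rpower_1 in Hr by auto. lra.
    + rewrite <- h in Hr, Hj. unfold rpow in Hr.
      destruct Rlt_dec; [lra|]. destruct Req_dec_T; lra.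
  - now apply (xlog_bound_fails_at_0 rho C2 f HC2), Happ.
Qed.

(** A disk with distant centre has radius at most a tenth of [|z_j|], so it cannot leave the annulus
    far enough to reach its middle from outside; disks centred near 0 stay in a bounded region. *)
Lemma disks_meeting_annulus (b M0 : R) (z : nat -> C) (r : nat -> R) :
  b < 1 -> (forall j, r j <= rpow (Cmod (z j)) b) -> (forall j, Cmod (z j) <= 1 -> r j <= M0) ->
  exists T0, 1 <= T0 /\ forall T, T0 < T -> forall w j,
    13 / 10 * T <= Cmod w <= 17 / 10 * T -> Cmod (w - z j) < r j ->
    T <= Cmod (z j) < 2 * T /\ r j <= 2 * Rpower T b.
Proof.
  intros Hb Hr HM.
  destruct (Rpower_eventually_gt (1 - b) 10) as [X0 [HX0 HX]]; [lra|].
  (* Disks with [|z_j| <= 1] lie within [1 + M0] of 0, those with [1 < |z_j| <= X0] within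
     [2 * X0]. *)
  exists (1 + 2 * X0 + Rabs M0). split; [pose proof (Rabs_pos M0); lra|].
  intros T HT w j Hw Hj. pose proof (Rabs_pos M0). pose proof (Rle_abs M0).
  pose proof (Cmod_triangle_sub w (z j)) as H1.
  pose proof (Cmod_triangle_sub (z j) w) as H2. rewrite (Cmod_sub_comm (z j) w) in H2.
  specialize (Hr j). set (t := Cmod (z j)) in *.
  destruct (Rle_lt_dec t 1) as [h1|h1]; [specialize (HM j h1); lra|].
  rewrite rpow_pos in Hr by lra.
  assert (Et : t = Rpower t b * Rpower t (1 - b)).
  { rewrite <- Rpower_plus. replace (b + (1 - b)) with 1 by ring. rewrite Rpower_1; lra. }
  assert (Hp : 0 < Rpower t b) by apply exp_pos.
  destruct (Rle_lt_dec t X0) as [h2|h2].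
  { exfalso. assert (Rpower t b <= t); [|lra].
    rewrite <- (Rpower_1 t) at 2 by lra. apply Rle_Rpower; lra. }
  specialize (HX t h2).
  assert (10 * Rpower t b <= t) by (rewrite Et at 2; nra).
  assert (T <= t < 2 * T) by lra. split; auto.
  eapply Rle_trans; [exact Hr|].
  pose proof (exp_pos (b * ln T)) as HTb. fold (Rpower T b) in HTb.
  (* The power increases or decreases according to the sign of [b], so [t < 2 * T] is used in one
     case and [T <= t] in the other. *)
  destruct (Rle_lt_dec 0 b) as [h|h].
  - apply Rle_trans with (Rpower (2 * T) b); [apply Rle_Rpower_l; lra|].
    rewrite <- Rpower_mult_distr by lra. apply Rmult_le_compat_r; [lra|].
    rewrite <- (Rpower_1 2) at 2 by lra. apply Rle_Rpower; lra.
  - apply Rle_trans with (Rpower T b); [|lra].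
    unfold Rpower. destruct (Req_dec t T) as [->|]; [lra|].
    left. apply exp_increasing. assert (ln T < ln t) by (apply ln_increasing; lra). nra.
Qed.

Lemma annulus_sum_ge (z : nat -> C) (r : nat -> R) (T x : R) (n : nat) :
  (forall j, 0 <= r j) ->
  x <= sum_n (fun j => if Rle_dec T (Cmod (z j)) then
      if Rlt_dec (Cmod (z j)) (2 * T) then r j else 0 else 0) n ->
  Rbar_le (Finite x) (annulus_sum z r T).
Proof.
  intros Hr Hx. rewrite <- (Lim_seq_const x). apply Lim_seq_le_loc.
  exists n. intros m Hm. eapply Rle_trans; [exact Hx|].
  replace m with (n + (m - n))%nat by lia. apply sum_n_incr.
  intros j. destruct Rle_dec; [destruct Rlt_dec|]; auto; lra.
Qed.

Theorem theorem1 (rho C2 eps : R) (f : C -> C) (E : C -> Prop)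
    (z : nat -> C) (r : nat -> R)
    (hrho : 0 < rho) (hC2 : 0 < C2) (heps : 0 < eps)
    (heps_le : eps <= rho / 2)
    (hf : entire f)
    (happrox : forall w : C, ~ E w ->
       Rbar_le
         (Rbar_abs (Rbar_minus (Finite (rpow (Cmod w) rho)) (xlog (Cmod (f w)))))
         (Rbar_mult (Finite C2) (xlog (Cmod w))))
    (hcover : forall w : C, E w -> exists j : nat, disk (z j) (r j) w)
    (hr0 : forall j : nat, 0 <= r j)
    (hr : forall j : nat, r j <= rpow (Cmod (z j)) (1 - rho / 2 + eps))
    (hbdd : exists M : R, forall j : nat, Cmod (z j) <= 1 -> r j <= M) :
  exists R_eps : R, forall T : R, R_eps < T ->
    Rbar_le (Finite (rpow T (1 + rho / 2 - 2 * C2 - 3 * eps)))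
            (annulus_sum z r T).
Proof.
  assert (heps_lt := eps_lt_half_rho rho C2 eps f E z r hC2 heps_le happrox hcover hr).
  assert (Hf : forall p, exists l, cder f p l) by (intros p; apply ex_derive_cder, hf).
  destruct hbdd as [M0 HM0].
  set (b := 1 - rho / 2 + eps) in *.
  assert (Hb : b < 1) by (unfold b; lra).
  destruct (disks_meeting_annulus b M0 z r Hb hr HM0) as [T1 [HT1 Hdisk]].
  destruct (local_radii_sum rho C2 eps f hrho hC2 heps heps_lt Hf) as [T2 Hlocal].
  destruct (Rpower_eventually_gt (1 - b) 1000) as [T3 [_ Hlarge]]; [lra|].
  (* The number 260 is [10 * 2 * 13]: grid side [T / 10], rounding loss 2, spacing [13 * s]. *)
  destruct (Rpower_eventually_gt (eps / 2) (260 ^ 2)) as [T4 [_ Hslack]]; [lra|].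
  exists (Rmax (Rmax T1 T2) (Rmax T3 T4)). intros T HT.
  assert (T1 < T) by (eapply Rle_lt_trans; [|exact HT];
    eapply Rle_trans; [apply Rmax_l|apply Rmax_l]).
  assert (T2 < T) by (eapply Rle_lt_trans; [|exact HT];
    eapply Rle_trans; [apply Rmax_r|apply Rmax_l]).
  assert (T3 < T) by (eapply Rle_lt_trans; [|exact HT];
    eapply Rle_trans; [apply Rmax_l|apply Rmax_r]).
  assert (T4 < T) by (eapply Rle_lt_trans; [|exact HT];
    eapply Rle_trans; [apply Rmax_r|apply Rmax_r]).
  specialize (Hdisk T ltac:(auto)). specialize (Hlocal T ltac:(auto)).
  specialize (Hlarge T ltac:(auto)). specialize (Hslack T ltac:(auto)).
  rewrite rpow_pos by lra.
  fold b in Hlocal. set (s := Rpower T b) in *.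
  set (sg := Rpower T (1 - rho / 2 - 2 * C2 - eps / 2)) in *.
  assert (Hs : 0 < s) by apply exp_pos.
  assert (HsT : 1000 * s <= T).
  { assert (ET : T = s * Rpower T (1 - b)).
    { unfold s. rewrite <- Rpower_plus. replace (b + (1 - b)) with 1 by ring. rewrite Rpower_1; lra. }
    rewrite ET. nra. }
  (* A disk of radius at most [2 * s] meeting the [4 * s]-neighbourhood of a grid point has its
     centre within [6 * s] of it; spacing [13 * s] exceeds twice that. The grid lies in moduli from
     [1.4 T] to [1.6 T]. *)
  destruct (separated_grid (14 / 10 * T) (13 * s) (T / 10)) as [a [k [Hk [Ha Hsep]]]]; [lra|lra|lra|].
  set (v := fun j => if Rle_dec T (Cmod (z j)) then
      if Rlt_dec (Cmod (z j)) (2 * T) then r j else 0 else 0).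
  destruct (separated_radii_sum z r v a (6 * s) sg k) as [n Hn]; auto.
  - intros j. unfold v. destruct Rle_dec; [destruct Rlt_dec|]; auto; lra.
  - intros i j Hi Hj. specialize (Ha i Hi). unfold v.
    pose proof (Cmod_triangle_sub (z j) (a i)). pose proof (Cmod_triangle_sub (a i) (z j)).
    rewrite (Cmod_sub_comm (a i) (z j)) in *.
    destruct Rle_dec; [destruct Rlt_dec|]; lra.
  - intros i i' Hi Hi' Hne. specialize (Hsep i i' Hi Hi' Hne). lra.
  - intros i Hi. specialize (Ha i Hi).
    destruct (Hlocal (a i) z (near_radius z r (a i) (6 * s))) as [n Hn].
    + lra.
    + intros j. unfold near_radius. destruct Rle_dec; auto; lra.
    + intros w Hw Hfree.
      pose proof (Cmod_triangle_sub w (a i)). pose proof (Cmod_triangle_sub (a i) w).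
      rewrite (Cmod_sub_comm (a i) w) in *.
      (* Avoiding the truncated disks is enough: a disk of the full family containing [w] would have
         its centre within [6 * s] of [a i], so it was kept. *)
      assert (HnE : ~ E w).
      { intros HE. destruct (hcover w HE) as [j Hj]. unfold disk in Hj.
        destruct (Hdisk w j ltac:(lra) Hj) as [Hzj Hrj].
        specialize (Hfree j). unfold near_radius in Hfree.
        destruct Rle_dec as [h|h]; [lra|]. apply h.
        pose proof (Cmod_sub_triangle (z j) w (a i)). rewrite (Cmod_sub_comm (z j) w) in *. lra. }
      destruct (log_close_of_xlog rho C2 f w ltac:(lra) (happrox w HnE)) as [h1 h2].
      split; auto. eapply Rle_trans; [exact h2|].
      apply Rmult_le_compat_l; [lra|]. apply ln_le; lra.
    + exists n. lra.
  - apply annulus_sum_ge with n; auto. eapply Rle_trans; [|exact Hn].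
    assert (Hsg : 0 < sg) by apply exp_pos.
    apply Rle_trans with ((T / 10 / (2 * (13 * s))) ^ 2 * sg);
      [|apply Rmult_le_compat_r; [lra|exact Hk]].
    set (Y := Rpower T (1 + rho / 2 - 2 * C2 - 3 * eps)).
    assert (HY : 0 < Y) by apply exp_pos.
    assert (Epow : T * T * sg = Y * Rpower T (eps / 2) * (s * s)).
    { transitivity (Rpower T 1 * Rpower T 1 * sg); [rewrite Rpower_1 by lra; ring|].
      unfold sg, Y, s. rewrite <- !Rpower_plus. f_equal. unfold b. field. }
    replace ((T / 10 / (2 * (13 * s))) ^ 2 * sg) with ((T * T * sg) / (260 ^ 2 * (s * s))) by (field; lra).
    rewrite Epow.
    replace (Y * Rpower T (eps / 2) * (s * s) / (260 ^ 2 * (s * s))) with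
      (Y * (Rpower T (eps / 2) / 260 ^ 2)) by (field; lra).
    rewrite <- (Rmult_1_r Y) at 1. apply Rmult_le_compat_l; [lra|].
    apply Rle_div_r; lra.
Qed.
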